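(* There exists a non-degenerate random variable $W>0$ such that $$\lim_{x\to 0} N_h(x)\,x^3=W \quad\text{almost surely.}$$
   Context: Unbiased three-dimensional random fragmentation of the unit cube. The rectangular cuboids that ever appear are indexed by the vertices of the infinite binary tree, the root being the unit cube. A cuboid is recorded by its side lengths $(a,b,c)$ in the directions $e_1,e_2,e_3$ of the standard basis. Each cuboid is split in two, independently of all others, by a planar plate that passes through a uniformly distributed point of the cuboid, is orthogonal to $e_1$, $e_2$ or $e_3$ with probability $1/3$ each, and extends to the boundary of the cuboid. That is, with $U$ uniform on $[0,1]$ independent of the chosen direction (and all choices independent over the vertices of the tree), $(a,b,c)$ is replaced by $\{(aU,b,c),(a(1-U),b,c)\}$, $\{(a,bU,c),(a,b(1-U),c)\}$ or $\{(a,b,cU),(a,b,c(1-U))\}$, with probability $1/3$ each. The process is continued indefinitely (complete fragmentation: every cuboid in the tree is eventually split). A horizontal plate is a plate orthogonal to $e_3$; when it splits a cuboid with side lengths $(a,b,c)$ its area is $ab$. $N_h(x)$ denotes the number of horizontal plates with area at least $x$ in the limit pattern, i.e. among all plates that ever appear in the complete fragmentation. ''Non-degenerate'' for a limit random variable $W$ means $0<W<\infty$ almost surely. *)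

(* Defs.v *)
From HB Require Import structures.
From mathcomp Require Import all_boot all_order all_algebra.
From mathcomp Require Import all_classical all_reals all_analysis.
From mathcomp Require Import measurable_realfun.

Set Implicit Arguments.
Unset Strict Implicit.
Unset Printing Implicit Defensive.

Import Order.TTheory GRing.Theory Num.Theory.
Import numFieldNormedType.Exports.

Local Open Scope classical_set_scope.
Local Open Scope ring_scope.

Definition mutually_independent d (T : measurableType d) (R : realType)
    (P : probability T R) (I : eqType) (F : I -> set (set T)) : Prop :=
  forall (s : seq I) (A : I -> set T), uniq s -> (forall i, i \in s -> F i (A i)) ->
  P (\bigcap_(i in [set` s]) A i) = (\prod_(i <- s) P (A i))%E.

(* Vertices of the infinite binary tree. The root is [::] and the children of v
   are false :: v and true :: v, so the last step is the head of the word. *)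
Definition vertex := seq bool.

Definition direction := 'I_3.
Definition e1 : direction := @Ordinal 3 0 isT.
Definition e2 : direction := @Ordinal 3 1 isT.
Definition e3 : direction := @Ordinal 3 2 isT.

Section fragmentation.
Context d (T : measurableType d) (R : realType) (P : probability T R).
(* The cuboid at v is split orthogonally to D v, in the proportions U v and
   1 - U v. *)
Variables (U : vertex -> {RV P >-> R}) (D : vertex -> T -> direction).

(* The variables (U v) and (D v), over all v, are taken together as one family,
   indexed by inl v and inr v, and generate the sigma-algebras below. *)
Definition choice_events (i : vertex + vertex) : set (set T) :=
  match i with
  | inl v => preimage_set_system setT (U v) measurable
  | inr v => preimage_set_system setT (D v) (@discrete_measurable direction)
  end.

Definition unbiased_fragmentation : Prop :=
  [/\ forall v (A : set R), measurable A ->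
        distribution P (U v) A = uniform_prob (@ltr01 R) A,
      forall v i, measurable (D v @^-1` [set i]) /\
        P (D v @^-1` [set i]) = (3%:R^-1)%:E
    & mutually_independent P choice_events].

Fixpoint sides (v : vertex) (w : T) : direction -> R :=
  match v with
  | [::] => fun=> 1
  | b :: v' => fun j =>
      if j == D v' w then sides v' w j * (if b then 1 - U v' w else U v' w)
      else sides v' w j
  end.

Definition horizontal_plate_area (v : vertex) (w : T) : R :=
  sides v w e1 * sides v w e2.

(* Each vertex carries exactly one plate, so plates are counted by vertices. *)
Definition N_h (w : T) (x : R) : \bar R :=
  counting [set v : vertex | D v w = e3 /\ x <= horizontal_plate_area v w].

End fragmentation.

Definition nondegenerate_rv d (T : measurableType d) (R : realType)
    (P : probability T R) (W : {RV P >-> \bar R}) : Prop :=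
  {ae P, forall w, (0 < W w)%E /\ (W w < +oo)%E}.

(* Main.v *)
From HB Require Import structures.
Require Import Defs.
From mathcomp Require Import all_boot all_order all_algebra.
From mathcomp Require Import all_classical all_reals all_analysis.
From mathcomp Require Import measurable_realfun.
From mathcomp Require Import ring lra.

Import Order.TTheory GRing.Theory Num.Theory.
Import numFieldNormedType.Exports.

Local Open Scope classical_set_scope.
Local Open Scope ring_scope.

(** Write [X v] for the area of the horizontal section of the cuboid at the
    vertex [v], and [W_n] for the sum of [X v ^ 3] over generation [n]. A split
    multiplies the area of a child by 1 with probability 1/3 and by a uniform
    variable with probability 2/3, so the sum over the two children of the
    [p]-th power of the factor has mean 2/3 + 4/(3(p+1)). This equals 1 at
    [p = 3] and 14/15 at [p = 4]. Hence [W_n] is a martingale, while the mean of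
    the sum of [X v ^ 4] over generation [n] is [(14/15)^n]
    ([expect_level_area4]).

    Let [N x] be the number of horizontal plates of area at least [x]. Its mean
    is (4 x^-3 - 1)/3 for [x <= 1], and 0 for [x > 1]; subtracting the mean
    (4/3) x^-3 of (4/3) x^-3 W leaves [count_mean x 1], whose absolute value is
    at most (4/3) x^-2. So the martingale of the conditional expectations of
    N x - (4/3) x^-3 W has differences that are sums over a generation of
    centred terms of size at most [5 (X v / x) ^ 2]. Terms at distinct vertices
    of one generation are orthogonal, because the split at a vertex is
    independent of all the other splits, so the second moment of the difference
    over generation [n] is at most [25 x^-4 (14/15)^n] ([expect_level_sqr]).

    The geometric decay gives a weighted sum of squared differences, the
    [energy], with mean of order [x^-4], which controls the whole series of
    differences by the Cauchy-Schwarz inequality ([sqr_increments_le_energy]).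
    Along x = 1/k, the variables k^-6 energy have summable means, hence tend to
    0 almost surely, and so does N(1/k) k^-3 - (4/3) W ([plate_count_inv_cvg]).
    Since [N] is monotone and consecutive inverse integers have ratio tending to
    1, the convergence extends to all x -> 0 ([cvg_interpolation_inv]).

    The limit [W] is finite because its own energy is. By Chebyshev's inequality
    the event W = 0 has probability at most a universal q < 1, for every family
    of splits with the law considered here ([extinction_le]). That event forces
    the same event in both subtrees of the root, which are independent and have
    the same law, so its probability is at most q^(2^n) for all [n]
    ([extinction_pow]), that is, 0. *)

(** * Expectations of bounded random variables *)

Section bounded_expectation.
Context {d} {T : measurableType d} {R : realType} (P : probability T R).
Implicit Types f g : T -> R.

(** A bounded real random variable. *)
Definition bounded_rv f :=
  measurable_fun setT f /\ exists M : R, forall w, `|f w| <= M.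

Lemma bounded_rv_integrable f : bounded_rv f -> P.-integrable setT (EFin \o f).
Proof.
move=> [mf [M fM]]; apply: (measurable_bounded_integrable measurableT _ mf).
  by rewrite /= probability_setT ltry.
exists M; split; first exact: num_real.
by move=> N MN w _; exact: le_trans (fM w) (ltW MN).
Qed.

Lemma bounded_rv_cst (c : R) : bounded_rv (fun=> c).
Proof. by split; [exact: measurable_cst | exists `|c|]. Qed.

Lemma bounded_rvD f g : bounded_rv f -> bounded_rv g ->
  bounded_rv (fun w => f w + g w).
Proof.
move=> [mf [M fM]] [mg [N gN]]; split; first exact: measurable_funD.
by exists (M + N) => w; rewrite (le_trans (ler_normD _ _))// lerD.
Qed.

Lemma bounded_rvM f g : bounded_rv f -> bounded_rv g ->
  bounded_rv (fun w => f w * g w).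
Proof.
move=> [mf [M fM]] [mg [N gN]]; split; first exact: measurable_funM.
by exists (M * N) => w; rewrite normrM ler_pM.
Qed.

Lemma bounded_rvX f n : bounded_rv f -> bounded_rv (fun w => f w ^+ n).
Proof.
move=> bf; elim: n => [|n ih].
  by under eq_fun do rewrite expr0; exact: bounded_rv_cst.
by under eq_fun do rewrite exprS; exact: bounded_rvM.
Qed.

Lemma bounded_rv_sum (I : eqType) (s : seq I) (F : I -> T -> R) :
  (forall i, i \in s -> bounded_rv (F i)) ->
  bounded_rv (fun w => \sum_(i <- s) F i w).
Proof.
elim: s => [|i s ih] bF.
  by under eq_fun do rewrite big_nil; exact: bounded_rv_cst.
under eq_fun do rewrite big_cons.
apply: bounded_rvD; first by apply: bF; rewrite mem_head.
by apply: ih => j js; apply: bF; rewrite inE js orbT.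
Qed.

Lemma expect_cst (c : R) : \int[P]_w c = c.
Proof. by rewrite Rintegral_cst//= probability_setT mulr1. Qed.

Lemma expectD f g : bounded_rv f -> bounded_rv g ->
  \int[P]_w (f w + g w) = \int[P]_w f w + \int[P]_w g w.
Proof. by move=> bf bg; rewrite RintegralD//; exact: bounded_rv_integrable. Qed.

Lemma expectZ (c : R) f : bounded_rv f -> \int[P]_w (c * f w) = c * \int[P]_w f w.
Proof. by move=> bf; rewrite RintegralZl//; exact: bounded_rv_integrable. Qed.

Lemma expect_le f g : bounded_rv f -> bounded_rv g ->
  (forall w, f w <= g w) -> \int[P]_w f w <= \int[P]_w g w.
Proof.
by move=> bf bg fg; apply: le_Rintegral => //; exact: bounded_rv_integrable.
Qed.

Lemma expect_sum (I : eqType) (s : seq I) (F : I -> T -> R) :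
  (forall i, i \in s -> bounded_rv (F i)) ->
  \int[P]_w (\sum_(i <- s) F i w) = \sum_(i <- s) \int[P]_w F i w.
Proof.
elim: s => [|i s ih] bF.
  under [LHS]eq_Rintegral do rewrite big_nil.
  by rewrite big_nil expect_cst.
under [LHS]eq_Rintegral do rewrite big_cons.
rewrite big_cons expectD.
- by rewrite ih// => j js; apply: bF; rewrite inE js orbT.
- by apply: bF; rewrite mem_head.
- by apply: bounded_rv_sum => j js; apply: bF; rewrite inE js orbT.
Qed.

Lemma expectE f : bounded_rv f -> (\int[P]_w f w)%:E = (\int[P]_w (f w)%:E)%E.
Proof.
by move=> bf; rewrite fineK//; apply: integrable_fin_num => //; exact: bounded_rv_integrable.
Qed.

End bounded_expectation.

(** * Independence *)

Section independence.
Context {d} {T : measurableType d} {R : realType} (P : probability T R).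

(** The events independent of a given event form a Dynkin system, so that
    independence passes from a pi-system to the sigma-algebra it generates. *)
Lemma independent_dynkin (G : set (set T)) (B : set T) :
  setI_closed G -> G `<=` measurable -> measurable B ->
  (forall A, G A -> P (A `&` B) = (P A * P B)%E) ->
  forall A, <<s G >> A -> measurable A /\ P (A `&` B) = (P A * P B)%E.
Proof.
move=> GI Gm mB GB A; rewrite -setI_closed_g_dynkin_g_sigma_algebra//.
move: A; apply: (@smallest_sub _ dynkin G
    [set A | measurable A /\ P (A `&` B) = (P A * P B)%E]); last first.
  by move=> C GC; split; [exact: Gm|exact: GB].
split=> /=.
- by rewrite setTI probability_setT mul1e.
- move=> C [mC CB]; split; first exact: measurableC.
  rewrite setIC -setDE measureD//=; last by rewrite -ge0_fin_numE// fin_num_measure.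
  rewrite setIC CB probability_setC// muleBl ?mul1e ?fin_num_measure//.
- move=> F tF HF; have mF n : measurable (F n) by have [] := HF n.
  split; first exact: bigcup_measurable.
  rewrite setI_bigcupl !measure_bigcup//=.
  + rewrite muleC -[P B]fineK ?fin_num_measure// -nneseriesZl//.
    apply: eq_eseriesr => n _.
    by have [_ ->] := HF n; rewrite fineK ?fin_num_measure// muleC.
  + by move=> n _; exact: measurableI.
  + exact: trivIset_setIr.
Qed.

(** Two pi-systems on which the product rule holds generate independent
    sigma-algebras. *)
Lemma independent_g_sigma (G H : set (set T)) :
  setI_closed G -> setI_closed H ->
  G `<=` measurable -> H `<=` measurable ->
  (forall A B, G A -> H B -> P (A `&` B) = (P A * P B)%E) ->
  forall A B, <<s G >> A -> <<s H >> B -> P (A `&` B) = (P A * P B)%E.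
Proof.
move=> GI HI Gm Hm GH A B sA sB.
have sGm : <<s G >> `<=` measurable.
  by apply: smallest_sub => //; exact: sigma_algebra_measurable.
have GsH C : H C -> P (A `&` C) = (P A * P C)%E.
  move=> HC; have CG D : G D -> P (D `&` C) = (P D * P C)%E by move=> /GH; exact.
  by have [_] := independent_dynkin G C GI Gm (Hm _ HC) CG A sA.
have AH C : H C -> P (C `&` A) = (P C * P A)%E.
  by move=> HC; rewrite setIC GsH// muleC.
have [_] := independent_dynkin H A HI Hm (sGm _ sA) AH B sB.
by rewrite setIC muleC.
Qed.

(** Integration of a function of two independent variables, one variable at a
    time. *)
Lemma expect_independent d1 d2 (T1 : measurableType d1) (T2 : measurableType d2)
    (V : T -> T1) (Z : T -> T2) (f : T1 * T2 -> R) :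
  measurable_fun setT V -> measurable_fun setT Z ->
  (forall A B, measurable A -> measurable B ->
     P (V @^-1` A `&` Z @^-1` B) = (P (V @^-1` A) * P (Z @^-1` B))%E) ->
  measurable_fun setT f -> (exists M, forall z, `|f z| <= M) ->
  \int[P]_w f (V w, Z w) = \int[P]_w (\int[P]_w' f (V w', Z w)).
Proof.
move=> mV mZ VZ mf bf.
pose V' : {mfun T >-> T1} := HB.pack V (isMeasurableFun.Build _ _ _ _ V mV).
pose Z' : {mfun T >-> T2} := HB.pack Z (isMeasurableFun.Build _ _ _ _ Z mZ).
pose VZf w := (V w, Z w).
have mVZ : measurable_fun setT VZf by exact: measurable_fun_pair.
pose VZ' : {mfun T >-> (T1 * T2)%type} :=
  HB.pack VZf (isMeasurableFun.Build _ _ _ _ VZf mVZ).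
have prodE : forall A, measurable A ->
  (distribution P V' \x distribution P Z')%E A = distribution P VZ' A.
  by apply: product_measure_unique => A B mA mB; rewrite /distribution/pushforward/= -VZ.
have bmf d' (T' : measurableType d') (g : T' -> T1 * T2) :
    measurable_fun setT g -> bounded_rv (f \o g).
  move=> mg; split; first exact: measurableT_comp.
  by case: bf => M fM; exists M => w; exact: fM.
have intf : (distribution P V' \x distribution P Z')%E.-integrable setT (EFin \o f).
  apply: (measurable_bounded_integrable measurableT _ mf).
    by have := prodE _ measurableT; rewrite /= => ->; rewrite probability_setT ltry.
  case: bf => M fM; exists M; split; first exact: num_real.
  by move=> N MN w _; exact: le_trans (fM w) (ltW MN).
rewrite /Rintegral; congr fine.
transitivity (\int[distribution P VZ']_z (f z)%:E)%E.
  rewrite integral_distribution//; first exact/measurable_EFinP.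
  by apply: bounded_rv_integrable; apply: (bmf _ _ VZf).
transitivity (\int[(distribution P V' \x distribution P Z')%E]_z (f z)%:E)%E.
  by apply: eq_measure_integral => A mA _; exact/esym/prodE.
pose g z := \int[P]_w f (V w, z).
have bf1 z : bounded_rv (fun w => f (V w, z)).
  by apply: (bmf _ _ (fun w => (V w, z))); exact: measurable_fun_pair.
have GE : fubini_G (distribution P V') (EFin \o f) = EFin \o g.
  apply/funext => z; rewrite /fubini_G /= expectE// integral_distribution//=.
  - by apply/measurable_EFinP; apply: measurableT_comp => //; exact: measurable_fun_pair.
  - exact: bounded_rv_integrable.
have mg : measurable_fun setT g.
  by apply/measurable_EFinP; rewrite -/(EFin \o g) -GE; exact: measurable_fubini_G intf.
rewrite -integral21_prod_meas1// GE integral_distribution//.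
  exact/measurable_EFinP.
apply: bounded_rv_integrable; split; first exact: measurableT_comp.
case: bf => M fM; exists M => w; rewrite /= (le_trans (le_normr_Rintegral _ _))//.
  exact: bounded_rv_integrable.
rewrite -[leRHS](expect_cst P); apply: expect_le => //; last exact: bounded_rv_cst.
split; first by apply: measurableT_comp => //; case: (bf1 (Z w)).
by exists M => w'; rewrite normr_id.
Qed.

End independence.

(** * Independence of groups of variables *)

Section grouping.
Context {d} {T : measurableType d} {R : realType} (P : probability T R).
Context {I : eqType} (F : I -> set (set T)).

(** Finite intersections of events carried by indices in [J]. *)
Definition cylinders (J : set I) : set (set T) :=
  [set B | exists s A, [/\ uniq s, forall i, i \in s -> J i,
    forall i, i \in s -> F i (A i) & B = \bigcap_(i in [set` s]) A i]].

Hypothesis FI : forall i, setI_closed (F i).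

Lemma cylinders_setI_closed (J : set I) : setI_closed (cylinders J).
Proof.
move=> _ _ [s [A [us sJ sF ->]]] [s' [A' [us' sJ' sF' ->]]].
pose A'' i := if i \in s then if i \in s' then A i `&` A' i else A i else A' i.
exists (undup (s ++ s')), A''; split.
- exact: undup_uniq.
- by move=> i; rewrite mem_undup mem_cat => /orP[/sJ|/sJ'].
- move=> i; rewrite mem_undup mem_cat /A''.
  case: (boolP (i \in s)) => [is_|_] /=; last exact: sF'.
  case: (boolP (i \in s')) => [is'|_] _; last exact: sF.
  by apply: FI; [exact: sF|exact: sF'].
- rewrite eqEsubset; split=> [x [xA xA'] i /=|x xA''].
    rewrite mem_undup mem_cat /A''.
    case: (boolP (i \in s)) => [is_|_] /=; last by move=> ?; exact: xA'.
    by case: (boolP (i \in s')) => [is'|_] _; [split; [exact: xA|exact: xA']|exact: xA].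
  split=> i /= is_; have := xA'' i; rewrite /= mem_undup mem_cat is_ ?orbT => /(_ isT).
    by rewrite /A'' is_; case: ifP => // _ [].
  by rewrite /A'' is_; case: ifP => // _ [].
Qed.

Hypothesis Fm : forall i, F i `<=` measurable.

Lemma cylinders_measurable (J : set I) : cylinders J `<=` measurable.
Proof.
move=> _ [s [A [_ _ sF ->]]]; apply: fin_bigcap_measurable; first exact: finite_seq.
by move=> i /= /sF /Fm.
Qed.

Hypothesis indepF : mutually_independent P F.

(** Mutually independent variables remain independent when gathered into two
    disjoint groups. *)
Lemma mutually_independent_groups (J K : set I) : J `&` K = set0 ->
  forall A B, <<s \bigcup_(i in J) F i >> A -> <<s \bigcup_(i in K) F i >> B ->
  P (A `&` B) = (P A * P B)%E.
Proof.
move=> JK0 A B sA sB.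
have sub (L : set I) : <<s \bigcup_(i in L) F i >> `<=` <<s cylinders L >>.
  apply: smallest_sub; first exact: smallest_sigma_algebra.
  move=> C [i Li FC]; apply: sub_gen_smallest.
  exists [:: i], (fun=> C); split => //.
  - by move=> j; rewrite inE => /eqP ->.
  - by move=> j; rewrite inE => /eqP ->.
  - by rewrite set_cons1 bigcap_set1.
apply: (independent_g_sigma P _ _ (cylinders_setI_closed J) (cylinders_setI_closed K)
  (cylinders_measurable J) (cylinders_measurable K)); [|exact: sub|exact: sub].
move=> _ _ [s [C [us sJ sF ->]]] [s' [C' [us' sJ' sF' ->]]].
have disj i : i \in s -> i \in s' -> False.
  by move=> /sJ Ji /sJ' Ki; have : (J `&` K) i by []; rewrite JK0.
pose C'' i := if i \in s then C i else C' i.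
have eqs : \bigcap_(i in [set` s]) C i = \bigcap_(i in [set` s]) C'' i.
  by apply: eq_bigcapr => i /= is_; rewrite /C'' is_.
have eqs' : \bigcap_(i in [set` s']) C' i = \bigcap_(i in [set` s']) C'' i.
  apply: eq_bigcapr => i /= is_; rewrite /C''; case: ifP => // /disj.
  by move=> /(_ is_).
have F1 i : i \in s -> F i (C'' i) by move=> is_; rewrite /C'' is_; exact: sF.
have F2 i : i \in s' -> F i (C'' i).
  by move=> is_; rewrite /C''; case: ifP => [/disj /(_ is_)//|_]; exact: sF'.
rewrite eqs eqs' -bigcap_setU (_ : [set` s] `|` [set` s'] = [set` s ++ s']); last first.
  by apply/seteqP; split=> i /=; rewrite mem_cat => /orP.
rewrite !indepF// ?big_cat//.
- rewrite cat_uniq us us' andbT/=; apply/hasPn => i is_; apply/negP => /disj.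
  by move=> /(_ is_).
- by move=> i; rewrite mem_cat => /orP[/F1|/F2].
Qed.

End grouping.

(** * The splitting variables *)

Section splits.
Context {d} {T : measurableType d} {R : realType} (P : probability T R).

(** The sigma-algebra generated by the variables [V v] with [v] in [J]. *)
Definition sigma_gen {T' : Type} (V : vertex -> T' -> R) (J : set vertex) :
    set (set T') :=
  \bigcup_(v in J) preimage_set_system setT (V v) measurable.

(** A family of independent splits, each encoded by one real number: the value 2
    stands for a horizontal plate, and any other value is the proportion [u] in
    which a vertical plate splits the area. Independence is required between any
    two families of splits with disjoint index sets. *)
Record iid_splits (V : vertex -> T -> R) : Prop := IidSplits {
  iid_measurable : forall v, measurable_fun setT (V v) ;
  iid_law : forall v (f : R -> R), measurable_fun setT f ->
    (exists M, forall y, `|f y| <= M) ->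
    \int[P]_w f (V v w) =
    3^-1 * f 2 + 2 / 3 * \int[@lebesgue_measure R]_(y in `[0, 1]) f y ;
  iid_indep : forall J K : set vertex, J `&` K = set0 ->
    forall A B, <<s sigma_gen V J >> A -> <<s sigma_gen V K >> B ->
    P (A `&` B) = (P A * P B)%E }.

Lemma setI_closed_preimage d' (T' : measurableType d') (U : Type) (f : U -> T') :
  setI_closed (preimage_set_system setT f measurable).
Proof.
move=> _ _ [A mA <-] [B mB <-]; exists (A `&` B); first exact: measurableI.
by rewrite !setTI preimage_setI.
Qed.

End splits.

(** * Integrals over the unit interval *)

Section unit_interval.
Context {R : realType}.
Local Notation mu := (@lebesgue_measure R).

Lemma integrable_sub01 (A : set R) (g : R -> R) :
  measurable A -> A `<=` `[0, 1] -> measurable_fun setT g ->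
  (exists K, forall y, 0 <= y <= 1 -> `|g y| <= K) ->
  mu.-integrable A (EFin \o g).
Proof.
move=> mA A01 mg [K gK]; apply: (@integrableS _ _ _ mu `[0, 1]%classic) => //.
apply: measurable_bounded_integrable => //.
- by rewrite /= lebesgue_measure_itv/= lte01 oppr0 adde0 ltry.
- exact: measurable_funTS.
- exists K; split; first exact: num_real.
  by move=> N KN y /=; rewrite in_itv/= => y01; exact: le_trans (gK y y01) (ltW KN).
Qed.

Lemma Rintegral01_oo (g : R -> R) : measurable_fun setT g ->
  (exists K, forall y, 0 <= y <= 1 -> `|g y| <= K) ->
  \int[mu]_(y in `[0, 1]) g y = \int[mu]_(y in `]0, 1[) g y.
Proof.
move=> mg gK; rewrite Rintegral_itv_bndo_bndc ?Rintegral_itv_obnd_cbnd//.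
  apply: integrable_sub01 => // y /=; rewrite !in_itv/= => /andP[y0 ->].
  by rewrite ltW.
apply: integrable_sub01 => // y /=; rewrite !in_itv/= => /andP[y0 y1].
by rewrite !ltW.
Qed.

Lemma Rintegral01_onem (g : R -> R) : measurable_fun setT g ->
  (exists K, forall y, 0 <= y <= 1 -> `|g y| <= K) ->
  \int[mu]_(y in `[0, 1]) g (1 - y) = \int[mu]_(y in `[0, 1]) g y.
Proof.
move=> mg gK; pose r (y : measurableTypeR R) : measurableTypeR R := 1 - y.
have mr : measurable_fun setT r.
  apply: measurable_funB; first exact: measurable_cst.
  exact: (@measurable_id _ R setT).
pose r' : {mfun measurableTypeR R >-> measurableTypeR R} :=
  HB.pack r (isMeasurableFun.Build _ _ _ _ r mr).
have rE A : measurable A -> mu A = pushforward mu r' A.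
  move=> mA; apply: lebesgue_measure_unique => // _ [[a b]] _ <-.
  change (mu `]a, b]%classic = mu (r @^-1` `]a, b]%classic)).
  rewrite (_ : r @^-1` _ = `[1 - b, 1 - a[%classic); last first.
    by apply/seteqP; split=> y /=; rewrite !in_itv/= /r; lra.
  rewrite !lebesgue_measure_itv/= !lte_fin ltrD2l ltrN2; case: ifP => // _.
  by rewrite -!EFinB; congr EFin; ring.
have r01 : r @^-1` `[0, 1] = `[0, 1]%classic.
  by apply/seteqP; split=> y /=; rewrite !in_itv/= /r; lra.
rewrite /Rintegral; congr fine.
transitivity (\int[pushforward mu r']_(y in `[0%R, 1%R]) (g y)%:E)%E; last first.
  by apply: eq_measure_integral => A mA _; exact/esym/rE.
rewrite integral_pushforward//=; first by rewrite r01.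
  exact/measurable_EFinP.
rewrite r01; apply: integrable_sub01 => //.
  exact: measurableT_comp mg mr.
case: gK => K gK; exists K => y y01; apply: gK; rewrite /r; lra.
Qed.

Lemma Rintegral_exprn n (s : R) : 0 < s ->
  \int[mu]_(y in `[0, s]) (y ^+ n) = s ^+ n.+1 / n.+1%:R.
Proof.
move=> s0; rewrite /Rintegral.
have cX x : {for x, continuous (fun y : R => y ^+ n.+1 / n.+1%:R)}.
  by apply: cvgM; [exact: exprn_continuous|exact: cvg_cst].
rewrite (@continuous_FTC2 _ _ (fun x => x ^+ n.+1 / n.+1%:R))//=.
- by rewrite expr0n/= mul0r subr0.
- by apply: continuous_in_subspaceT => x _; exact: exprn_continuous.
- split.
  + by move=> x _; apply: derivableM => //; exact: exprn_derivable.
  + by apply: cvg_at_right_filter; exact: cX.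
  + by apply: cvg_at_left_filter; exact: cX.
- move=> x _; rewrite derive1Mr; last exact: exprn_derivable.
  by rewrite exp_derive1/= /GRing.scale/= mulrAC divff// mul1r.
Qed.

End unit_interval.

(** * The splits of the fragmentation process *)

Section splits_of_fragmentation.
Context {d} {T : measurableType d} {R : realType} (P : probability T R).
Variables (U : vertex -> {RV P >-> R}) (D : vertex -> T -> direction).
Hypothesis hUD : unbiased_fragmentation U D.

(** The encoding of the choices [U v] and [D v] by one number. *)
Definition split_of (v : vertex) (w : T) : R :=
  if D v w == e3 then 2 else U v w.

Let F := choice_events U D.

Let FI i : setI_closed (F i).
Proof.
case: i => v; first exact: setI_closed_preimage.
move=> _ _ [A mA <-] [B mB <-]; exists (A `&` B) => //.
by rewrite !setTI preimage_setI.
Qed.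

Let DE v (A : set direction) :
  D v @^-1` A = \bigcup_(i in A) (D v @^-1` [set i]).
Proof.
by rewrite eqEsubset; split=> [w Aw|w [i Ai /= ->]] //; exists (D v w).
Qed.

Let Fm i : F i `<=` measurable.
Proof.
case: hUD => _ hD _; case: i => v _ [A mA <-]; rewrite setTI.
  exact: measurable_sfunP.
rewrite DE; apply: fin_bigcup_measurable; first exact: finite_finset.
by move=> i _; have [] := hD v i.
Qed.

Let indepF (J K : set (vertex + vertex)) : J `&` K = set0 ->
  forall A B, <<s \bigcup_(i in J) F i >> A -> <<s \bigcup_(i in K) F i >> B ->
  P (A `&` B) = (P A * P B)%E.
Proof. case: hUD => _ _ indep.
exact: (mutually_independent_groups P F FI Fm indep).
Qed.

Lemma measurable_split_of v : measurable_fun setT (split_of v).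
Proof.
apply: measurable_fun_ifT => //.
apply: (@measurable_fun_bool _ _ _ _ true); rewrite setTI.
rewrite [X in measurable X](_ : _ = D v @^-1` [set e3]); first by case: hUD => _ /(_ v e3)[].
by apply/seteqP; split=> w /= /eqP.
Qed.

(** The integral against the uniform law is known for nonnegative functions, so
    the bound [M] is first added to [f]. *)
Lemma uniform_expect v (f : R -> R) : measurable_fun setT f ->
  (exists M, forall y, `|f y| <= M) ->
  \int[P]_w f (U v w) = \int[@lebesgue_measure R]_(y in `[0, 1]) f y.
Proof.
move=> mf [M fM].
have bfU : bounded_rv (fun w => f (U v w)).
  by split; [exact: measurableT_comp|exists M].
apply: (addIr M).
rewrite -[in LHS](expect_cst P M) -expectD//; last exact: bounded_rv_cst.
transitivity (\int[@lebesgue_measure R]_(y in `[0, 1]) (f y + M)); last first.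
  rewrite RintegralD//; [|by apply: integrable_sub01 => //; exists M|].
    congr (_ + _); rewrite Rintegral_cst//= lebesgue_measure_itv/= lte01.
    by rewrite oppr0 adde0 mulr1.
  by apply: (@integrable_sub01 _ _ (fun=> M)) => //; exists `|M|.
have mg : measurable_fun setT (fun y => (f y + M)%:E).
  by apply/measurable_EFinP; exact: measurable_funD.
have g0 y : (0 <= (f y + M)%:E)%E.
  by rewrite lee_fin -lerBlDr sub0r; have := fM y; rewrite ler_norml => /andP[].
congr fine.
have mUv : @measurable_fun _ _ T (measurableTypeR R) setT (U v).
  exact: (measurable_funPT (U v)).
pose V : {mfun T >-> measurableTypeR R} :=
  HB.pack (U v : T -> measurableTypeR R) (isMeasurableFun.Build _ _ _ _ _ mUv).
rewrite -(@ge0_integral_distribution _ _ _ _ _ P V (fun y => (f y + M)%:E))//.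
transitivity (\int[uniform_prob (@ltr01 R)]_y (f y + M)%:E)%E.
  by apply: eq_measure_integral => A mA _; case: hUD => /(_ v A mA).
by rewrite integral_uniform// subr0 invr1 mul1e.
Qed.

Let third i v : P (D v @^-1` [set i]) = (3^-1)%:E.
Proof. by case: hUD => _ /(_ v i)[]. Qed.

Let sigma_split_of (J : set vertex) (K : set (vertex + vertex)) :
  (forall v, J v -> K (inl v) /\ K (inr v)) ->
  <<s sigma_gen split_of J >> `<=` <<s \bigcup_(i in K) F i >>.
Proof.
move=> JK; apply: smallest_sub; first exact: smallest_sigma_algebra.
move=> _ [v /JK[Kl Kr] [A mA <-]].
pose TK := g_sigma_algebraType (\bigcup_(i in K) F i).
suff : measurable_fun setT (split_of v : TK -> R) by move/(_ measurableT A mA).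
apply: measurable_fun_ifT => //.
  apply: (@measurable_fun_bool _ _ _ _ true); rewrite setTI.
  apply: sub_gen_smallest; exists (inr v) => //; exists [set e3] => //.
  by rewrite setTI; apply/seteqP; split=> w /= /eqP.
move=> _ B mB.
by apply: sub_gen_smallest; exists (inl v) => //; exists B.
Qed.

Lemma unbiased_iid_splits : iid_splits P split_of.
Proof.
split.
- exact: measurable_split_of.
- move=> v f mf [M fM].
  pose c := \int[P]_w f (U v w).
  pose J w : R := \1_(D v @^-1` [set e3]) w.
  have mD : measurable (D v @^-1` [set e3]) by case: hUD => _ /(_ v e3)[].
  have mJ : measurable_fun setT J by exact: measurable_indic.
  have J01 w : J w = (D v w == e3)%:R.
    by rewrite /J indicE; congr (nat_of_bool _)%:R; apply/idP/eqP; rewrite inE.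
  have bJ : bounded_rv J.
    by split=> //; exists 1 => w; rewrite J01; case: eqP; rewrite ?normr1 ?normr0.
  pose g (z : R * R) := if z.2 == 1 then f 2 else f z.1.
  have -> : \int[P]_w f (split_of v w) = \int[P]_w g (U v w, J w).
    apply: eq_Rintegral => w _; rewrite /g/= J01 /split_of; case: (D v w == e3); rewrite /= ?eqxx//.
    by rewrite (eq_sym 0) oner_eq0.
  rewrite expect_independent//.
  + rewrite (_ : (fun _ => _) = fun w => c + (f 2 - c) * J w); last first.
      apply/funext => w; rewrite /g/= J01; case: (D v w == e3) => /=.
        by rewrite eqxx expect_cst mulr1 addrC subrK.
      by rewrite (eq_sym 0) oner_eq0 mulr0 addr0.
    rewrite expectD ?expectZ ?expect_cst//; last 2 first.
      exact: bounded_rv_cst.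
      by apply: bounded_rvM => //; exact: bounded_rv_cst.
    have -> : \int[P]_w J w = 3^-1.
      by rewrite /Rintegral integral_indic//= setIT third.
    have -> : c = \int[@lebesgue_measure R]_(y in `[0, 1]) f y.
      by apply: uniform_expect => //; exists M.
    by field.
  + move=> A B mA mB.
    apply: (indepF [set inl v] [set inr v]).
    * by rewrite -subset0 => i [/= -> ].
    * by apply: sub_gen_smallest; exists (inl v) => //; exists A; rewrite ?setTI.
    * apply: sub_gen_smallest; exists (inr v) => //.
      exists [set i | B (i == e3)%:R] => //; rewrite setTI.
      by apply/seteqP; split=> w /=; rewrite J01.
  + apply: measurable_fun_ifT => //.
      by apply: measurable_fun_eqr.
    exact: measurableT_comp.
  + by exists M => z; rewrite /g; case: ifP.
- move=> J K JK A B sA sB.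
  pose dbl (L : set vertex) : set (vertex + vertex) :=
    [set i | match i with inl v => L v | inr v => L v end].
  apply: (indepF (dbl J) (dbl K)).
  + rewrite -subset0 => -[v|v] [/= Jv Kv].
      by have : (J `&` K) v by []; rewrite JK.
    by have : (J `&` K) v by []; rewrite JK.
  + exact: sigma_split_of sA.
  + exact: sigma_split_of sB.
Qed.

End splits_of_fragmentation.

(** * Areas and generations *)

Section areas.
Context {R : realType}.

(** The proportion [u], replaced by 1/2 in the negligible case where it is not in
    the open unit interval; areas are then positive everywhere. *)
Definition clamp (u : R) : R := if 0 < u < 1 then u else 2^-1.

Lemma clamp_range u : 0 < clamp u < 1.
Proof.
rewrite /clamp; case: ifP => // _.
by rewrite invr_gt0 ltr0n invf_lt1 ?ltr1n.
Qed.

Lemma measurable_clamp : measurable_fun setT clamp.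
Proof.
apply: measurable_fun_ifT => //; apply: measurable_and.
  by apply: measurable_fun_ltr.
by apply: measurable_fun_ltr.
Qed.

(** The factor by which a split encoded by [y] multiplies the area of the child
    [b]. *)
Definition ratio (b : bool) (y : R) : R :=
  if y == 2 then 1 else if b then 1 - clamp y else clamp y.

Lemma ratio_range b y : 0 < ratio b y <= 1.
Proof.
rewrite /ratio; case: eqP => _; first by rewrite ltr01 lexx.
by have /andP[? ?] := clamp_range y; case: b; apply/andP; split; lra.
Qed.

Lemma measurable_ratio b : measurable_fun setT (ratio b).
Proof.
apply: measurable_fun_ifT => //; first by apply: measurable_fun_eqr.
case: b; last exact: measurable_clamp.
by apply: measurable_funB => //; exact: measurable_clamp.
Qed.

Context {T : Type} (V : vertex -> T -> R).

(** The area of the horizontal section of the cuboid at [v]. *)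
Fixpoint area (v : vertex) (w : T) : R :=
  match v with
  | [::] => 1
  | b :: v' => area v' w * ratio b (V v' w)
  end.

Lemma area_range v w : 0 < area v w <= 1.
Proof.
elim: v => [|b v /andP[ih0 ih1]] /=; first by rewrite ltr01 lexx.
have /andP[r0 r1] := ratio_range b (V v w).
by rewrite mulr_gt0//= mulr_ile1// ltW.
Qed.

End areas.

Lemma measurable_area (R : realType) (d : measure_display) (T : measurableType d)
    (V : vertex -> T -> R) (v : vertex) :
  (forall u, (size u < size v)%N -> measurable_fun setT (V u)) ->
  measurable_fun setT (area V v).
Proof.
elim: v => [|b v ih] mV; first exact: measurable_cst.
apply: measurable_funM.
  by apply: ih => u uv; apply: mV; rewrite ltnW.
by apply: measurableT_comp; [exact: measurable_ratio|exact: mV].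
Qed.

(** The vertices of generation [n]. *)
Fixpoint level (n : nat) : seq vertex :=
  if n is n'.+1 then map (cons true) (level n') ++ map (cons false) (level n')
  else [:: [::]].

Lemma mem_level n (v : vertex) : (v \in level n) = (size v == n).
Proof.
elim: n v => [|n ih] v; first by rewrite inE size_eq0.
have mem_cons b c (u : vertex) :
    (c :: u \in map (cons b) (level n)) = (c == b) && (size u == n).
  apply/mapP/andP => [[x]|[/eqP -> un]].
    by rewrite ih => xn [-> ->].
  by exists u; rewrite ?ih.
case: v => [|c v] /=.
  by rewrite mem_cat; apply/orP => -[]/mapP[].
by rewrite mem_cat !mem_cons eqSS; case: c; rewrite ?orbF.
Qed.

Lemma uniq_level n : uniq (level n).
Proof.
elim: n => //= n ih; rewrite cat_uniq !map_inj_uniq ?ih ?andbT//=; last 2 first.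
- by move=> ? ? [].
- by move=> ? ? [].
by apply/hasPn => _ /mapP[u _ ->]; apply/mapP => -[].
Qed.

Lemma big_levelS (R : zmodType) n (f : vertex -> R) :
  \sum_(v <- level n.+1) f v =
  \sum_(v <- level n) (f (true :: v) + f (false :: v)).
Proof. by rewrite big_cat !big_map big_split. Qed.

Lemma measurable_fun_comp2 (R : realType) (d : measure_display)
    (T : measurableType d) (xi : R -> R -> R) (f g : T -> R) :
  measurable_fun setT (fun z : R * R => xi z.1 z.2) ->
  measurable_fun setT f -> measurable_fun setT g ->
  measurable_fun setT (fun w => xi (f w) (g w)).
Proof.
move=> mxi mf mg.
exact: (measurableT_comp mxi (measurable_fun_pair mf mg)).
Qed.

(** * Orthogonality along a generation *)

Section generation.
Context {d} {T : measurableType d} {R : realType} (P : probability T R).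
Variable V : vertex -> T -> R.
Hypothesis hV : iid_splits P V.

Let mV v : measurable_fun setT (V v). Proof. exact: iid_measurable hV v. Qed.

Let mA v : measurable_fun setT (area V v). Proof. exact: measurable_area. Qed.

(** The probability space seen through all the splits except the one at [v]. *)
Definition others (v : vertex) := g_sigma_algebraType (sigma_gen V [set~ v]).

Lemma measurable_others v u : u != v -> measurable_fun setT (V u : others v -> R).
Proof.
move=> /eqP uv _ A mA'; apply: sub_gen_smallest; exists u => //.
by exists A.
Qed.

Lemma others_measurable v (A : set (others v)) :
  measurable A -> (measurable : set (set T)) A.
Proof.
move: A; apply: smallest_sub; first exact: sigma_algebra_measurable.
by move=> _ [u _ [A mA' <-]]; exact: mV.
Qed.

(** The split at [v] can be integrated first, the area of [v] and any variable
    [Z] determined by the other splits being held fixed. *)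
Lemma expect_split v (xi : R -> R -> R) (K M : R) (Z : others v -> R) :
  measurable_fun setT (fun z => xi z.1 z.2) ->
  (forall y a, 0 < a <= 1 -> `|xi y a| <= K) ->
  measurable_fun setT Z -> (forall w, `|Z w| <= M) ->
  \int[P]_w (xi (V v w) (area V v w) * Z w) =
  \int[P]_w ((\int[P]_w' xi (V v w') (area V v w)) * Z w).
Proof.
move=> mxi xiK mZ ZM.
have mAo : measurable_fun setT (area V v : others v -> R).
  apply: (@measurable_area R _ (others v) V v) => u uv; apply: measurable_others.
  by apply: contraTneq uv => ->; rewrite ltnn.
pose f (z : R * others v) := xi z.1 (area V v z.2) * Z z.2.
rewrite (@expect_independent _ T R P _ _ _ (others v) (V v) id f) //.
- apply: eq_Rintegral => w _; rewrite /f /= mulrC -RintegralZl//.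
    by apply: eq_Rintegral => w' _; rewrite mulrC.
  apply: bounded_rv_integrable; split.
    exact: measurable_fun_comp2.
  by exists K => w'; rewrite xiK// area_range.
- by move=> _ A /others_measurable; rewrite setTI.
- move=> A B mA' mB; apply: (iid_indep _ _ hV [set v] [set~ v]) => //.
    by rewrite setICr.
  by apply: sub_gen_smallest; exists v => //; exists A; rewrite ?setTI.
- apply: measurable_funM; last exact: measurableT_comp.
  apply: measurable_fun_comp2 => //; exact: measurableT_comp.
- by exists (K * M) => z; rewrite normrM ler_pM// xiK// area_range.
Qed.

End generation.

(** * Moments of the splits *)

Section split_moments.
Context {d} {T : measurableType d} {R : realType} (P : probability T R).
Variable V : vertex -> T -> R.
Hypothesis hV : iid_splits P V.
Local Notation mu := (@lebesgue_measure R).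

Let mV v : measurable_fun setT (V v). Proof. exact: iid_measurable hV v. Qed.

Let mA v : measurable_fun setT (area V v). Proof. exact: measurable_area. Qed.

Lemma expect_ratio (b : bool) v (h : R -> R) : measurable_fun setT h ->
  (exists K, forall y, 0 <= y <= 1 -> `|h y| <= K) ->
  \int[P]_w h (ratio b (V v w)) = 3^-1 * h 1 + 2 / 3 * \int[mu]_(y in `[0, 1]) h y.
Proof.
move=> mh [K hK].
have bh : exists M, forall y, `|h (ratio b y)| <= M.
  by exists K => y; apply: hK; have /andP[/ltW -> ->] := ratio_range b y.
rewrite (iid_law _ _ hV v (h \o ratio b))//; last first.
  exact: measurableT_comp mh (measurable_ratio b).
rewrite /= {1}/ratio eqxx; congr (_ + _ * _).
have -> : \int[mu]_(y in `[0, 1]) h y =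
    \int[mu]_(y in `[0, 1]) h (if b then 1 - y else y).
  by case: b {bh} => //; rewrite Rintegral01_onem//; exists K.
rewrite !Rintegral01_oo//.
- apply: eq_Rintegral => y; rewrite inE/= in_itv/= => /andP[y0 y1].
  rewrite /ratio /clamp y0 y1; case: eqP => // y2; move: y1; rewrite y2; lra.
- exact: measurableT_comp mh (measurable_ratio b).
- by case: bh => M hM; exists M => y _; exact: hM.
- have mb : measurable_fun setT (fun y : R => if b then 1 - y else y).
    case: b {bh}; last exact: measurable_id.
    by apply: measurable_funB; [exact: measurable_cst|exact: measurable_id].
  exact: measurableT_comp mh mb.
- by exists K => y y01; apply: hK; case: b {bh} => //; lra.
Qed.

Lemma expect_ratioX (b : bool) v n :
  \int[P]_w (ratio b (V v w)) ^+ n = 3^-1 + 2 / 3 / n.+1%:R.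
Proof.
rewrite (expect_ratio b v (fun y => y ^+ n)).
- by rewrite Rintegral_exprn// !expr1n mulr1 !mul1r.
- exact: exprn_measurable.
- by exists 1 => y /andP[y0 y1]; rewrite ger0_norm ?exprn_ge0// exprn_ile1.
Qed.

Lemma bounded_rv_areaX v n : bounded_rv (fun w => area V v w ^+ n).
Proof.
apply: bounded_rvX; split => //; exists 1 => w.
by have /andP[a0 a1] := area_range V v w; rewrite ger0_norm// ltW.
Qed.

Lemma bounded_rv_ratioX b v n : bounded_rv (fun w => ratio b (V v w) ^+ n).
Proof.
apply: bounded_rvX; split; first exact: measurableT_comp (measurable_ratio b) _.
by exists 1 => w; have /andP[a0 a1] := ratio_range b (V v w); rewrite ger0_norm// ltW.
Qed.

(** The expected factor per generation is twice 1/3 + (2/3)/5 = 7/15. *)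
Lemma expect_level_area4 n :
  \int[P]_w (\sum_(v <- level n) area V v w ^+ 4) = (14 / 15) ^+ n.
Proof.
elim: n => [|n ih].
  under eq_Rintegral do rewrite /= big_seq1 expr1n.
  by rewrite expect_cst expr0.
under eq_Rintegral do rewrite big_levelS.
rewrite exprSr -ih -RintegralZr//; last first.
  by apply: bounded_rv_integrable; apply: bounded_rv_sum => v _; exact: bounded_rv_areaX.
under [RHS]eq_Rintegral do rewrite mulr_suml.
have bM v b : bounded_rv (fun w => area V (b :: v) w ^+ 4) by exact: bounded_rv_areaX.
rewrite !expect_sum; last 2 first.
- by move=> v _; apply: bounded_rvM; [exact: bounded_rv_areaX|exact: bounded_rv_cst].
- by move=> v _; apply: bounded_rvD.
apply: eq_bigr => v _.
rewrite expectD// (_ : 14 / 15 = 7 / 15 + 7 / 15); last by field.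
rewrite RintegralZr//; last by apply: bounded_rv_integrable; exact: bounded_rv_areaX.
rewrite mulrDr.
have bE b : \int[P]_w area V (b :: v) w ^+ 4 = \int[P]_w area V v w ^+ 4 * (7 / 15).
  transitivity (\int[P]_w ((ratio b (V v w) * area V v w) ^+ 4 * 1)).
    by apply: eq_Rintegral => w _; rewrite /= mulr1 mulrC.
  rewrite (expect_split P V hV v (fun y a => (ratio b y * a) ^+ 4) 1 1 (fun=> 1))//.
  - rewrite -RintegralZr//; last by apply: bounded_rv_integrable; exact: bounded_rv_areaX.
    apply: eq_Rintegral => w _; rewrite mulr1.
    under eq_Rintegral do rewrite exprMn.
    rewrite RintegralZr//; last by apply: bounded_rv_integrable; exact: bounded_rv_ratioX.
    by rewrite expect_ratioX mulrC; congr (_ * _); field.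
  - apply: measurable_funX; apply: measurable_funM => //.
    exact: measurableT_comp (measurable_ratio b) _.
  - move=> y a /andP[a0 a1]; have /andP[r0 r1] := ratio_range b y.
    have ra0 : 0 <= ratio b y * a by rewrite mulr_ge0 ?ltW.
    by rewrite ger0_norm ?exprn_ge0// exprn_ile1// mulr_ile1// ltW.
  - by move=> w; rewrite normr1.
by rewrite !bE.
Qed.

(* The term [xi y a] is attached to a cuboid of area [a] with split [y]; it is
   centred, and of the order of the square of the area. *)
Variables (xi : R -> R -> R) (K : R).
Hypothesis mxi : measurable_fun setT (fun z : R * R => xi z.1 z.2).
Hypothesis xiK : forall y a, 0 < a <= 1 -> `|xi y a| <= K * a ^+ 2.
Hypothesis xi0 : forall v a, 0 < a <= 1 -> \int[P]_w xi (V v w) a = 0.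

Let K0 : 0 <= K.
Proof.
by have := xiK 0 1; rewrite ltr01 lexx expr1n mulr1 => /(_ isT); apply: le_trans.
Qed.

Let xi_le y a : 0 < a <= 1 -> `|xi y a| <= K.
Proof.
move=> /andP[a0 a1]; rewrite (le_trans (xiK y a _)) ?a0//.
by rewrite -[leRHS]mulr1 ler_wpM2l// exprn_ile1// ltW.
Qed.

Local Notation eta v := (fun w => xi (V v w) (area V v w)).

Lemma bounded_rv_increment v : bounded_rv (eta v).
Proof.
split; first exact: measurable_fun_comp2.
by exists K => w; rewrite xi_le// area_range.
Qed.

(** An increment is centred given all the other splits. *)
Lemma expect_increment v M (Z : others V v -> R) : measurable_fun setT Z ->
  (forall w, `|Z w| <= M) -> \int[P]_w (eta v w * Z w) = 0.
Proof.
move=> mZ ZM; rewrite (expect_split P V hV v xi K M)//.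
under eq_Rintegral do rewrite xi0 ?area_range// mul0r.
exact: expect_cst.
Qed.

Lemma expect_level_increment n : \int[P]_w (\sum_(v <- level n) eta v w) = 0.
Proof.
rewrite expect_sum; last by move=> v _; exact: bounded_rv_increment.
rewrite big1// => v _; rewrite -[RHS](expect_increment v 1 (fun=> 1))//.
  by apply: eq_Rintegral => w _; rewrite mulr1.
by move=> w; rewrite normr1.
Qed.

(** Increments at distinct vertices of one generation are orthogonal. *)
Lemma expect_level_sqr n :
  \int[P]_w (\sum_(v <- level n) eta v w) ^+ 2 <= K ^+ 2 * (14 / 15) ^+ n.
Proof.
have orth s : uniq s -> {subset s <= level n} ->
    \int[P]_w (\sum_(v <- s) eta v w) ^+ 2 = \sum_(v <- s) \int[P]_w eta v w ^+ 2.
  elim: s => [|v s ih] /=.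
    by under eq_Rintegral do rewrite big_nil expr0n; rewrite big_nil expect_cst.
  move=> /andP[vs us] sl; rewrite big_cons -ih//; last first.
    by move=> u us'; apply: sl; rewrite inE us' orbT.
  have bs : bounded_rv (fun w => \sum_(v <- s) eta v w).
    by apply: bounded_rv_sum => u _; exact: bounded_rv_increment.
  have bv := bounded_rv_increment v.
  transitivity (\int[P]_w (eta v w ^+ 2 + 2 * (eta v w * \sum_(v <- s) eta v w) +
      (\sum_(v <- s) eta v w) ^+ 2)).
    apply: eq_Rintegral => w _; rewrite big_cons sqrrD.
    by rewrite [in LHS]mulr2n [in RHS]mulrDl !mul1r.
  rewrite !expectD ?expectZ//; last 5 first.
  - exact: bounded_rvM.
  - exact: bounded_rvX.
  - by apply: bounded_rvM; [exact: bounded_rv_cst|exact: bounded_rvM].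
  - apply: bounded_rvD; first exact: bounded_rvX.
    by apply: bounded_rvM; [exact: bounded_rv_cst|exact: bounded_rvM].
  - exact: bounded_rvX.
  have vn : size v = n by apply/eqP; rewrite -mem_level; apply: sl; rewrite mem_head.
  have [mZ [M sM]] : @bounded_rv _ (others V v) R (fun w => \sum_(u <- s) eta u w).
    apply: bounded_rv_sum => u us'.
    have uv : u != v by apply: contraNneq vs => <-.
    have un : size u = n.
      by apply/eqP; rewrite -mem_level; apply: sl; rewrite inE us' orbT.
    split; last by exists K => w; rewrite xi_le// area_range.
    apply: measurable_fun_comp2 => //; first exact: measurable_others.
    apply: measurable_area => x xu; apply: measurable_others.
    by apply: contraTneq xu => ->; rewrite un vn ltnn.
  by rewrite (expect_increment v M (fun w => \sum_(v <- s) eta v w))// mulr0 addr0.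
rewrite orth ?uniq_level//.
rewrite -expect_level_area4 -expectZ; last first.
  by apply: bounded_rv_sum => v _; exact: bounded_rv_areaX.
under [leRHS]eq_Rintegral do rewrite mulr_sumr.
rewrite expect_sum; last first.
  by move=> v _; apply: bounded_rvM; [exact: bounded_rv_cst|exact: bounded_rv_areaX].
apply: ler_sum => v _; apply: expect_le.
- by apply: bounded_rvX; exact: bounded_rv_increment.
- by apply: bounded_rvM; [exact: bounded_rv_cst|exact: bounded_rv_areaX].
- move=> w; rewrite -real_normK ?num_real// (_ : _ * _ = (K * area V v w ^+ 2) ^+ 2).
    have KA : 0 <= K * area V v w ^+ 2 by rewrite mulr_ge0// sqr_ge0.
    by rewrite ler_sqr ?nnegrE//; apply: xiK; exact: area_range.
  by rewrite exprMn -exprM.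
Qed.

End split_moments.

(** * Summation over the generations *)

Section weighted_sums.
Context {R : realType}.

Lemma geometric_sum_le (r : R) n : 0 <= r < 1 -> \sum_(j < n) r ^+ j <= (1 - r)^-1.
Proof.
move=> /andP[r0 r1]; have r1' : 0 < 1 - r by rewrite subr_gt0.
rewrite -[leRHS]mul1r ler_pdivlMr//.
have := subrX1 r n; have := exprn_ge0 n r0; lra.
Qed.

(** Weighted Cauchy-Schwarz inequality. *)
Lemma sqr_sum_le (d b : nat -> R) n : (forall j, 0 < b j) ->
  (\sum_(j < n) d j) ^+ 2 <= (\sum_(j < n) b j) * \sum_(j < n) d j ^+ 2 / b j.
Proof.
move=> b0; elim: n => [|n ih]; first by rewrite !big_ord0 mul0r expr0n.
rewrite !big_ord_recr /=.
set s := \sum_(i < n) d i in ih *; set B := \sum_(i < n) b i in ih *.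
set G := \sum_(i < n) _ in ih *.
have bn := b0 n; set x := d n; set y := b n in bn *.
have B0 : 0 <= B by apply: sumr_ge0 => j _; exact: ltW.
have G0 : 0 <= G by apply: sumr_ge0 => j _; rewrite divr_ge0 ?sqr_ge0// ltW.
have -> : (B + y) * (G + x ^+ 2 / y) = B * G + x ^+ 2 + (B * x ^+ 2 / y + y * G).
  by field; rewrite gt_eqF.
(* Since [s ^ 2 <= B * G], this is the inequality between the arithmetic and
   geometric means of the two terms on the right; the case [B = 0] is apart
   because the square below is completed by dividing by [B]. *)
suff : 2 * s * x <= B * x ^+ 2 / y + y * G by move: ih; nra.
move: B0; rewrite le_eqVlt => /predU1P[B0|B0].
  move: ih; rewrite -B0 mul0r => s0.
  have -> : s = 0 by apply/eqP; rewrite -sqrf_eq0 eq_le s0 sqr_ge0.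
  by rewrite mulr0 !mul0r add0r mulr_ge0// ltW.
have sG : y * (s ^+ 2 / B) <= y * G.
  by rewrite ler_pM2l// ler_pdivrMr// mulrC.
apply: le_trans (lerD (lexx _) sG).
rewrite -subr_ge0.
have -> : B * x ^+ 2 / y + y * (s ^+ 2 / B) - 2 * s * x =
    (B * x - y * s) ^+ 2 / (B * y).
  by field; rewrite !gt_eqF.
by rewrite divr_ge0 ?sqr_ge0// ltW// mulr_gt0.
Qed.

Lemma nneseries_lty_cvg (u : nat -> R) : (forall n, 0 <= u n) ->
  (\sum_(n <oo) (u n)%:E < +oo)%E -> cvgn (series u).
Proof.
move=> u0 uoo.
have S0 : (0 <= \sum_(n <oo) (u n)%:E)%E.
  by apply: nneseries_ge0 => n _ _; rewrite lee_fin.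
apply: nondecreasing_is_cvgn.
  by apply/nondecreasing_seqP => n; rewrite /series/= big_nat_recr//= lerDl.
exists (fine (\sum_(n <oo) (u n)%:E)) => _ [n _ <-].
rewrite -lee_fin fineK ?ge0_fin_numE// /series/= -sumEFin.
by apply: nneseries_lim_ge => k _ _; rewrite lee_fin.
Qed.

End weighted_sums.

Section as_series.
Context {d} {T : measurableType d} {R : realType} (P : probability T R).

Lemma integral_series_le (f : nat -> T -> \bar R) (c : nat -> R) (C : R) :
  (forall n, measurable_fun setT (f n)) -> (forall n w, (0 <= f n w)%E) ->
  (forall n, (\int[P]_w f n w <= (c n)%:E)%E) ->
  (forall n, \sum_(k < n) c k <= C) ->
  (\int[P]_w \sum_(n <oo) f n w <= C%:E)%E.
Proof.
move=> mf f0 fc cC; rewrite integral_nneseries//.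
apply: lime_le; first by apply: is_cvg_nneseries => n _ _; exact: integral_ge0.
near=> n; apply: (@le_trans _ _ (\sum_(k < n) c k)%:E); last by rewrite lee_fin.
by rewrite big_mkord -sumEFin; apply: lee_sum => k _.
Unshelve. all: by end_near. Qed.

Lemma ae_lty (f : T -> \bar R) (C : R) : measurable_fun setT f ->
  (forall w, (0 <= f w)%E) -> (\int[P]_w f w <= C%:E)%E ->
  {ae P, forall w, (f w < +oo)%E}.
Proof.
move=> mf f0 fC.
have intf : P.-integrable setT f.
  apply/integrableP; split=> //.
  under eq_integral do rewrite gee0_abs//.
  exact: le_lt_trans fC (ltry C).
apply: filterS (integrable_ae measurableT intf) => w /(_ I).
by rewrite ge0_fin_numE.
Qed.

End as_series.

Section energy.
Context {R : realType} {T : Type} (V : vertex -> T -> R) (xi : R -> R -> R).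

(** The increment over generation [n] of the martingale with differences [xi]. *)
Definition increment (n : nat) (w : T) : R :=
  \sum_(v <- level n) xi (V v w) (area V v w).

(** A weighted sum of squared increments; its finiteness makes the series of
    increments converge. The ratio 29/30 of the weights lies between 14/15, the
    rate of decay of the second moments of the increments, and 1. *)
Definition energy (w : T) : \bar R :=
  \sum_(n <oo) (increment n w ^+ 2 / (29 / 30) ^+ n)%:E.

Lemma energy_ge0 w : (0 <= energy w)%E.
Proof.
by apply: nneseries_ge0 => n _ _; rewrite lee_fin divr_ge0 ?sqr_ge0 ?exprn_ge0.
Qed.

Lemma sqr_increments_le_energy n w :
  (((\sum_(j < n) increment j w) ^+ 2)%:E <= 30%:E * energy w)%E.
Proof.
have b0 j : 0 < (29 / 30 : R) ^+ j by rewrite exprn_gt0//; lra.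
apply: (@le_trans _ _ (30%:E *
    (\sum_(j < n) increment j w ^+ 2 / (29 / 30) ^+ j)%:E)%E).
  rewrite -EFinM lee_fin.
  apply: le_trans (sqr_sum_le (increment^~ w) (fun j => (29 / 30) ^+ j) n b0) _.
  apply: ler_wpM2r.
    by apply: sumr_ge0 => j _; rewrite divr_ge0 ?sqr_ge0// ltW.
  apply: (le_trans (@geometric_sum_le _ (29 / 30) n _)); first lra.
  by rewrite (_ : 1 - 29 / 30 = 30^-1) ?invrK//; field.
apply: lee_wpmul2l; first by rewrite lee_fin.
apply: (@le_trans _ _ (\sum_(0 <= j < n) (increment j w ^+ 2 / (29 / 30) ^+ j)%:E)%E).
  by rewrite big_mkord sumEFin.
by apply: nneseries_lim_ge => j _ _; rewrite lee_fin divr_ge0 ?sqr_ge0 ?exprn_ge0.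
Qed.

Lemma energy_cvg w : (energy w < +oo)%E -> cvgn (series (increment^~ w)).
Proof.
move=> Ew; apply: normed_cvg.
have b0 j : 0 < (29 / 30 : R) ^+ j by rewrite exprn_gt0//; lra.
apply: (@series_le_cvg _ _ (fun j => (29 / 30) ^+ j + increment j w ^+ 2 / (29 / 30) ^+ j)).
- by move=> n; exact: normr_ge0.
- by move=> n; rewrite addr_ge0 ?divr_ge0 ?sqr_ge0// ltW.
- move=> n /=; set x := increment n w; set b := (29 / 30) ^+ n.
  have b0' : 0 < b by exact: b0.
  rewrite -subr_ge0 -(@pmulr_rge0 _ b)//.
  have -> : b * (b + x ^+ 2 / b - `|x|) = b ^+ 2 + x ^+ 2 - b * `|x|.
    by field; rewrite gt_eqF.
  by rewrite -(real_normK (num_real x)); have := normr_ge0 x; nra.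
- rewrite [X in cvgn X](_ : _ = series (fun j => (29 / 30) ^+ j : R) +
      series (fun j => increment j w ^+ 2 / (29 / 30) ^+ j)).
    apply: is_cvgD.
      have := @is_cvg_geometric_series R 1 (29 / 30); rewrite ger0_norm; last lra.
      rewrite (_ : geometric 1 (29 / 30) = fun j => (29 / 30) ^+ j).
        by apply; lra.
      by apply/funext => j; rewrite /geometric/= mul1r.
    apply: nneseries_lty_cvg => // n.
    by rewrite divr_ge0 ?sqr_ge0// ltW.
  by apply/funext => n; rewrite /series/= big_split.
Qed.

End energy.

Section energy_moments.
Context {d} {T : measurableType d} {R : realType} (P : probability T R).
Variable V : vertex -> T -> R.
Hypothesis hV : iid_splits P V.
Variable xi : R -> R -> R.
Local Notation D := (increment V xi).

Variable K : R.
Hypothesis mxi : measurable_fun setT (fun z : R * R => xi z.1 z.2).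
Hypothesis xiK : forall y a, 0 < a <= 1 -> `|xi y a| <= K * a ^+ 2.
Hypothesis xi0 : forall v a, 0 < a <= 1 -> \int[P]_w xi (V v w) a = 0.

Lemma bounded_rv_level_increment n : bounded_rv (D n).
Proof.
by apply: bounded_rv_sum => v _; exact: (bounded_rv_increment P V hV xi K).
Qed.

Lemma measurable_energy : measurable_fun setT (energy V xi).
Proof.
apply: ge0_emeasurable_sum.
  by move=> n w _ _; rewrite lee_fin divr_ge0 ?sqr_ge0 ?exprn_ge0.
move=> n _; apply/measurable_EFinP; apply: measurable_funM => //.
by apply: measurable_funX; case: (bounded_rv_level_increment n).
Qed.

Lemma integral_energy_le : (\int[P]_w energy V xi w <= (29 * K ^+ 2)%:E)%E.
Proof.
have b0 j : 0 < (29 / 30 : R) ^+ j by rewrite exprn_gt0//; lra.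
apply: (integral_series_le _ _ (fun n => K ^+ 2 * (28 / 29) ^+ n)).
- move=> n; apply/measurable_EFinP; apply: measurable_funM => //.
  by apply: measurable_funX; case: (bounded_rv_level_increment n).
- by move=> n w; rewrite lee_fin divr_ge0 ?sqr_ge0// ltW.
- move=> n.
  have bn : bounded_rv (fun w => D n w ^+ 2).
    by apply: bounded_rvX; exact: bounded_rv_level_increment.
  rewrite -expectE; last by apply: bounded_rvM => //; exact: bounded_rv_cst.
  rewrite lee_fin RintegralZr//; last exact: bounded_rv_integrable.
  rewrite ler_pdivrMr// -mulrA -exprMn (_ : 28 / 29 * (29 / 30) = 14 / 15); last by field.
  exact: (expect_level_sqr P V hV xi K).
- move=> n; rewrite -mulr_sumr mulrC ler_wpM2r ?sqr_ge0//.
  apply: (le_trans (@geometric_sum_le _ (28 / 29) n _)); first lra.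
  by rewrite (_ : 1 - 28 / 29 = 29^-1) ?invrK//; field.
Qed.

End energy_moments.

(** * The two martingales *)

Section cube_martingale.
Context {d} {T : measurableType d} {R : realType} (P : probability T R).
Variable V : vertex -> T -> R.
Hypothesis hV : iid_splits P V.

(** The difference of the martingale of the sums of the cubes of the areas. *)
Definition cube_diff (y a : R) : R :=
  a ^+ 3 * (ratio true y ^+ 3 + ratio false y ^+ 3 - 1).

Lemma measurable_cube_diff :
  measurable_fun setT (fun z : R * R => cube_diff z.1 z.2).
Proof.
apply: measurable_funM; first exact: measurable_funX.
apply: measurable_funB => //; apply: measurable_funD; apply: measurable_funX;
  exact: measurableT_comp (measurable_ratio _) _.
Qed.

Lemma cube_diff_le y a : 0 < a <= 1 -> `|cube_diff y a| <= 1 * a ^+ 2.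
Proof.
move=> /andP[/ltW a0 a1]; have a3 : 0 <= a ^+ 3 by exact: exprn_ge0.
rewrite normrM mul1r ger0_norm//.
have r01 b : 0 <= ratio b y ^+ 3 <= 1.
  have /andP[r0 r1] := ratio_range b y.
  by apply/andP; split; [apply: exprn_ge0|apply: exprn_ile1 => //]; exact: ltW.
have r2 : `|ratio true y ^+ 3 + ratio false y ^+ 3 - 1| <= 1.
  have := r01 true; have := r01 false; rewrite ler_norml; lra.
apply: le_trans (ler_piMr a3 r2) _.
by rewrite exprS ler_piMl// sqr_ge0.
Qed.

Lemma expect_cube_diff v a : \int[P]_w cube_diff (V v w) a = 0.
Proof.
have br b := bounded_rv_ratioX P V hV b v 3.
have bd : bounded_rv (fun w => ratio true (V v w) ^+ 3 + ratio false (V v w) ^+ 3 - 1).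
  by apply: bounded_rvD; [exact: bounded_rvD|exact: bounded_rv_cst].
rewrite expectZ// !expectD//; [|exact: bounded_rvD|exact: bounded_rv_cst].
rewrite !(expect_ratioX P V hV) expect_cst.
rewrite (_ : _ - 1 = 0) ?mulr0//; by field.
Qed.

End cube_martingale.

Section count_martingale.
Context {d} {T : measurableType d} {R : realType} (P : probability T R).
Variable V : vertex -> T -> R.
Hypothesis hV : iid_splits P V.
Local Notation mu := (@lebesgue_measure R).

(** For a cuboid of area [a], the expected number of horizontal plates of area at
    least [x] in its subtree, its own plate included, minus (4/3) (a/x)^3: that
    expected number is (4 (a/x)^3 - 1)/3 if [x <= a], and 0 otherwise. *)
Definition count_mean (x a : R) : R :=
  if x <= a then - 3^-1 else - (4 / 3) * (a / x) ^+ 3.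

(** The difference of the martingale that counts the plates of area at least [x]
    in the first generations and adds [count_mean x] over the current one. *)
Definition count_diff (x y a : R) : R :=
  ((y == 2) && (x <= a))%:R +
  (count_mean x (a * ratio true y) + count_mean x (a * ratio false y)) -
  count_mean x a.

Lemma measurable_count_mean x : measurable_fun setT (count_mean x).
Proof.
apply: measurable_fun_ifT => //; first exact: measurable_fun_ler.
apply: measurable_funM => //; apply: measurable_funX.
exact: measurable_funM.
Qed.

Lemma measurable_count_diff x :
  measurable_fun setT (fun z : R * R => count_diff x z.1 z.2).
Proof.
have mm b : measurable_fun setT (fun z : R * R => count_mean x (z.2 * ratio b z.1)).
  apply: (measurableT_comp (measurable_count_mean x)); apply: measurable_funM => //.
  exact: measurableT_comp (measurable_ratio b) _.
apply: measurable_funB; last exact: measurableT_comp (measurable_count_mean x) _.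
apply: measurable_funD; last exact: measurable_funD.
rewrite (_ : (fun _ => _) = fun z : R * R =>
    if (z.1 == 2) && (x <= z.2) then 1 else 0 : R); last first.
  by apply/funext => z; case: (_ && _).
apply: measurable_fun_ifT => //; apply: measurable_and.
  exact: measurable_fun_eqr.
exact: measurable_fun_ler.
Qed.

Variable x : R.
Hypothesis x0 : 0 < x.

Lemma count_mean_le a b : 0 <= b -> b <= a -> `|count_mean x b| <= 4 / 3 * (a / x) ^+ 2.
Proof.
move=> b0 ba; apply: (@le_trans _ _ (4 / 3 * (b / x) ^+ 2)); last first.
  have bx : b / x <= a / x by rewrite ler_pM2r ?invr_gt0.
  have bx0 : 0 <= b / x by rewrite divr_ge0// ltW.
  nra.
rewrite /count_mean; case: (lerP x b) => xb.
  have : 1 <= b / x by rewrite ler_pdivlMr// mul1r.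
  rewrite normrN ger0_norm ?invr_ge0 ?ler0n//; nra.
have bx1 : b / x <= 1 by rewrite ler_pdivrMr// mul1r ltW.
have bx0 : 0 <= b / x by rewrite divr_ge0// ltW.
rewrite mulNr normrN ger0_norm; last by apply: mulr_ge0; [lra|exact: exprn_ge0].
by apply: ler_wpM2l; [lra|rewrite exprS ler_piMl// sqr_ge0].
Qed.

Lemma count_diff_le y a : 0 < a <= 1 -> `|count_diff x y a| <= 5 / x ^+ 2 * a ^+ 2.
Proof.
move=> /andP[a0 a1].
have -> : 5 / x ^+ 2 * a ^+ 2 =
    (a / x) ^+ 2 + (4 / 3 * (a / x) ^+ 2 + 4 / 3 * (a / x) ^+ 2) + 4 / 3 * (a / x) ^+ 2.
  by field; rewrite gt_eqF.
rewrite /count_diff.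
apply: le_trans (ler_normB _ _) _; apply: lerD; last exact: count_mean_le (ltW a0) _.
apply: le_trans (ler_normD _ _) _; apply: lerD.
  case: (y == 2) => /=; last by rewrite normr0 sqr_ge0.
  case: (lerP x a) => xa; last by rewrite normr0 sqr_ge0.
  have : 1 <= a / x by rewrite ler_pdivlMr// mul1r.
  rewrite normr1; nra.
have cb b : `|count_mean x (a * ratio b y)| <= 4 / 3 * (a / x) ^+ 2.
  have /andP[r0 r1] := ratio_range b y.
  apply: count_mean_le; first by rewrite mulr_ge0// ltW.
  by rewrite ler_piMr// ltW.
by apply: le_trans (ler_normD _ _) _; exact: lerD.
Qed.

(** The integral over the proportion [y]: the integrand is cubic as long as
    [a * y < x], and constant afterwards. *)
Lemma Rintegral_count_mean a : 0 < a ->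
  \int[mu]_(y in `[0, 1]) count_mean x (a * y) =
  if x <= a then - 3^-1 else - 3^-1 * (a / x) ^+ 3.
Proof.
move=> a0.
have mX : measurable_fun setT (fun y : R => y ^+ 3) by exact: exprn_measurable.
have bX : exists K, forall y : R, 0 <= y <= 1 -> `|y ^+ 3| <= K.
  by exists 1 => y /andP[y0 y1]; rewrite ger0_norm ?exprn_ge0// exprn_ile1.
have mc : measurable_fun setT (fun y => count_mean x (a * y)).
  apply: (measurableT_comp (measurable_count_mean x)); exact: measurable_funM.
have bc : exists K, forall y : R, 0 <= y <= 1 -> `|count_mean x (a * y)| <= K.
  exists (4 / 3 * (a / x) ^+ 2) => y /andP[y0 y1]; apply: count_mean_le.
    by rewrite mulr_ge0// ltW.
  by rewrite ler_piMr// ltW.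
have cube y : a * y < x -> count_mean x (a * y) = - (4 / 3) * (a / x) ^+ 3 * y ^+ 3.
  by move=> yx; rewrite /count_mean leNgt yx/=; field; rewrite gt_eqF.
case: (lerP x a) => xa; last first.
  transitivity (\int[mu]_(y in `[0, 1]) (- (4 / 3) * (a / x) ^+ 3 * y ^+ 3)).
    apply: eq_Rintegral => y; rewrite inE/= in_itv/= => /andP[y0 y1]; apply: cube.
    by apply: le_lt_trans xa; rewrite ler_piMr// ltW.
  rewrite RintegralZl//; last exact: integrable_sub01.
  by rewrite Rintegral_exprn// expr1n; field; rewrite gt_eqF.
pose s := x / a; have s0 : 0 < s by rewrite divr_gt0.
have s1 : s <= 1 by rewrite ler_pdivrMr// mul1r.
have U01 : `[0, 1]%classic = `[0, s[ `|` `[s, 1] :> set R.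
  by apply/seteqP; split=> y /=; rewrite !in_itv/=; lra.
rewrite U01 Rintegral_setU//; last 2 first.
- by rewrite -U01; exact: integrable_sub01.
- by apply/disj_set2P/seteqP; split=> y //= []; rewrite !in_itv/=; lra.
rewrite (@eq_Rintegral _ _ _ mu `[0, s[%classic
  (fun y => - (4 / 3) * (a / x) ^+ 3 * y ^+ 3)); last first.
  move=> y; rewrite inE/= in_itv/= => /andP[y0 ys]; apply: cube.
  by rewrite mulrC -ltr_pdivlMr.
rewrite (@eq_Rintegral _ _ _ mu `[s, 1]%classic (fun=> - 3^-1)); last first.
  move=> y; rewrite inE/= in_itv/= => /andP[ys y1].
  by rewrite /count_mean mulrC -ler_pdivrMr// ys.
rewrite RintegralZl//; last first.
  by apply: integrable_sub01 => // y /=; rewrite !in_itv/=; lra.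
rewrite Rintegral_itv_bndo_bndc; last first.
  by apply: integrable_sub01 => // y /=; rewrite !in_itv/=; lra.
rewrite Rintegral_exprn// Rintegral_cst//= lebesgue_measure_itv/= lte_fin.
have a'0 : a != 0 by rewrite gt_eqF.
have x'0 : x != 0 by rewrite gt_eqF.
case: (ltrP s 1) => s1' /=; first by rewrite /s; field; rewrite a'0 x'0.
have xa' : x = a by rewrite -(divfK a'0 x) -/s (_ : s = 1) ?mul1r//; lra.
by rewrite /s xa'; field.
Qed.

Lemma expect_count_diff v a : 0 < a <= 1 -> \int[P]_w count_diff x (V v w) a = 0.
Proof.
move=> /andP[a0 a1].
have bc b : bounded_rv (fun w => count_mean x (a * ratio b (V v w))).
  split.
    apply: (measurableT_comp (measurable_count_mean x)); apply: measurable_funM => //.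
    by apply: measurableT_comp (measurable_ratio b) _; exact: iid_measurable hV v.
  exists (4 / 3 * (a / x) ^+ 2) => w; have /andP[r0 r1] := ratio_range b (V v w).
  apply: count_mean_le; first by rewrite mulr_ge0// ltW.
  by rewrite ler_piMr// ltW.
have mi : measurable_fun setT (fun y : R => ((y == 2) && (x <= a))%:R : R).
  rewrite (_ : (fun _ => _) = fun y : R =>
    if (y == 2) && (x <= a) then 1 else 0 : R); last first.
    by apply/funext => y; case: (_ && _).
  apply: measurable_fun_ifT => //; apply: measurable_and => //.
  exact: measurable_fun_eqr.
have bi01 (b : bool) : `|b%:R : R| <= 1 by case: b; rewrite ?normr1 ?normr0.
have bi : bounded_rv (fun w => ((V v w == 2) && (x <= a))%:R : R).
  split; last by exists 1 => w.
  by apply: (measurableT_comp mi); exact: iid_measurable hV v.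
have iE : \int[P]_w ((V v w == 2) && (x <= a)%R)%:R = 3^-1 * (x <= a)%R%:R :> R.
  rewrite (iid_law _ _ hV v (fun y => ((y == 2) && (x <= a))%:R))//; last by exists 1.
  rewrite eqxx/= (@eq_Rintegral _ _ _ mu `[0, 1]%classic (fun=> 0)).
    by rewrite Rintegral_cst// mul0r mulr0 addr0.
  move=> y; rewrite inE/= in_itv/= => /andP[y0 y1].
  by case: eqP => // y2; move: y1; rewrite y2; lra.
have cE b : \int[P]_w count_mean x (a * ratio b (V v w)) =
    3^-1 * count_mean x a + 2 / 3 * (if x <= a then - 3^-1 else - 3^-1 * (a / x) ^+ 3).
  rewrite (expect_ratio P V hV b v (fun y => count_mean x (a * y))).
  - by rewrite mulr1 Rintegral_count_mean.
  - by apply: (measurableT_comp (measurable_count_mean x)); exact: measurable_funM.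
  - exists (4 / 3 * (a / x) ^+ 2) => y /andP[y0 y1]; apply: count_mean_le.
      by rewrite mulr_ge0// ltW.
    by rewrite ler_piMr// ltW.
rewrite !expectD//; last 3 first.
- exact: bounded_rvD.
- by apply: bounded_rvD => //; exact: bounded_rvD.
- exact: bounded_rv_cst.
rewrite iE !cE expect_cst /count_mean; case: (x <= a) => /=; by field; rewrite ?gt_eqF.
Qed.

End count_martingale.

(** * The limit variable and its positivity *)

Section limit_variable.
Context {R : realType} {T : Type} (V : vertex -> T -> R).

(** The sum of the cubes of the areas over generation [n]. *)
Definition cube_sum (n : nat) (w : T) : R := \sum_(v <- level n) area V v w ^+ 3.

(** The limit of the sums of cubes; the superior limit makes it a measurable
    function on the whole probability space. *)
Definition cube_limit (w : T) : \bar R := limn_esup (fun n => (cube_sum n w)%:E).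

Lemma cube_sum_ge0 n w : 0 <= cube_sum n w.
Proof.
apply: sumr_ge0 => v _; rewrite exprn_ge0//.
by have /andP[/ltW] := area_range V v w.
Qed.

Lemma cube_sumE n w : cube_sum n w = 1 + \sum_(j < n) increment V cube_diff j w.
Proof.
elim: n => [|n ih].
  by rewrite big_ord0 addr0 /cube_sum/= big_seq1 expr1n.
rewrite big_ord_recr/= addrA -ih /increment /cube_sum big_levelS -big_split/=.
by apply: eq_bigr => v _; rewrite /cube_diff !exprMn; ring.
Qed.

Lemma cube_limitE w (l : R) : cube_sum^~ w @ \oo --> l -> cube_limit w = l%:E.
Proof.
move=> cl; have cl' : (fun n => (cube_sum n w)%:E) @ \oo --> l%:E.
  by apply/fine_cvgP; split; first exact: nearW.
rewrite /cube_limit is_cvg_limn_esupE; first exact/cvg_lim.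
by apply/cvg_ex; exists l%:E.
Qed.

Lemma cube_limit_eq0 w : cube_limit w = 0%E <-> cube_sum^~ w @ \oo --> (0 : R).
Proof.
split=> [W0|/cube_limitE//].
have : (fun n => (cube_sum n w)%:E) @ \oo --> 0%E.
  apply: limn_esup_le_cvg; first by rewrite -/(cube_limit w) W0.
  by move=> n; rewrite lee_fin cube_sum_ge0.
by move=> /fine_cvg.
Qed.

End limit_variable.

Lemma measurable_cube_limit (R : realType) (d : measure_display)
    (T : measurableType d) (V : vertex -> T -> R) :
  (forall v, measurable_fun setT (V v)) -> measurable_fun setT (cube_limit V).
Proof.
move=> mV; apply: measurable_fun_limn_esup => n; apply/measurable_EFinP.
apply: measurable_sum => v; apply: measurable_funX.
by apply: measurable_area => u _; exact: mV.
Qed.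

Section subtree.
Context {R : realType} {T : Type} (V : vertex -> T -> R).

(** The splits of the subtree below the child [b] of the root. *)
Definition subtree (b : bool) (v : vertex) : T -> R := V (rcons v b).

Lemma area_rcons b v w :
  area V (rcons v b) w = area (subtree b) v w * ratio b (V [::] w).
Proof.
elim: v => [|c v ih] /=; first by rewrite !mul1r.
by rewrite ih mulrAC.
Qed.

Lemma big_level_rcons n (f : vertex -> R) :
  \sum_(v <- level n.+1) f v =
  \sum_(v <- level n) (f (rcons v true) + f (rcons v false)).
Proof.
elim: n f => [|n ih] f; first by rewrite big_levelS /= !big_seq1.
rewrite big_levelS (ih (fun v => f (true :: v) + f (false :: v))) big_levelS.
by apply: eq_bigr => v _ /=; ring.
Qed.

Lemma cube_sumS n w : cube_sum V n.+1 w =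
  ratio true (V [::] w) ^+ 3 * cube_sum (subtree true) n w +
  ratio false (V [::] w) ^+ 3 * cube_sum (subtree false) n w.
Proof.
rewrite /cube_sum big_level_rcons !mulr_sumr -big_split.
by apply: eq_bigr => v _ /=; rewrite !area_rcons !exprMn; ring.
Qed.

(** The limit of the whole tree is a combination with positive coefficients of
    the limits of the two subtrees. *)
Lemma cube_limit0_subtree b w : cube_limit V w = 0%E -> cube_limit (subtree b) w = 0%E.
Proof.
move=> /cube_limit_eq0 V0; apply/cube_limit_eq0.
have /andP[r0 _] := ratio_range b (V [::] w).
have r3 : 0 < ratio b (V [::] w) ^+ 3 by rewrite exprn_gt0.
have u0 : (fun n => (ratio b (V [::] w) ^+ 3)^-1 * cube_sum V n.+1 w) @ \oo --> (0 : R).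
  rewrite -(mulr0 (ratio b (V [::] w) ^+ 3)^-1); apply: cvgM; first exact: cvg_cst.
  by rewrite (cvg_shiftS (cube_sum V ^~ w)).
apply: (squeeze_cvgr _ (cvg_cst 0) u0); apply: nearW => n.
rewrite cube_sum_ge0/= mulrC ler_pdivlMr// cube_sumS mulrC.
have t3 c : 0 <= ratio c (V [::] w) ^+ 3 * cube_sum (subtree c) n w.
  have /andP[/ltW c0 _] := ratio_range c (V [::] w).
  by rewrite mulr_ge0 ?exprn_ge0 ?cube_sum_ge0.
by case: b {r0 r3 u0}; [rewrite lerDl|rewrite lerDr].
Qed.

End subtree.

Section positivity.
Context {d} {T : measurableType d} {R : realType} (P : probability T R).

Lemma sigma_gen_subtree (V : vertex -> T -> R) b (J : set vertex) :
  <<s sigma_gen (subtree V b) J >> `<=`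
  <<s sigma_gen V [set rcons v b | v in J] >>.
Proof.
apply: smallest_sub; first exact: smallest_sigma_algebra.
by move=> A [v Jv VA]; apply: sub_gen_smallest; exists (rcons v b) => //; exists v.
Qed.

Lemma iid_splits_subtree V b : iid_splits P V -> iid_splits P (subtree V b).
Proof.
move=> hV; split.
- by move=> v; exact: iid_measurable hV _.
- by move=> v f mf bf; exact: (iid_law _ _ hV (rcons v b) f mf bf).
- move=> J K JK A B sA sB.
  apply: (iid_indep _ _ hV [set rcons v b | v in J] [set rcons v b | v in K]).
  + rewrite -subset0 => _ [[u Ju <-] [v Kv vu]].
    have uv : v = u by apply: (@rcons_injl _ b).
    by have : (J `&` K) u by [split => //; rewrite -uv]; rewrite JK.
  + exact: sigma_gen_subtree sA.
  + exact: sigma_gen_subtree sB.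
Qed.

(** The event that the limit vanishes. *)
Definition extinction (V : vertex -> T -> R) := [set w | cube_limit V w = 0%E].

Lemma measurable_extinction V :
  (forall v, measurable_fun setT (V v)) -> measurable (extinction V).
Proof.
move=> mV; rewrite (_ : extinction V = cube_limit V @^-1` [set 0%E]) //.
by rewrite -[X in measurable X]setTI; exact: (measurable_cube_limit _ _ _ V mV).
Qed.

(** Chebyshev's inequality around the level 871: the sums of cubes have mean 1
    and variance at most 30 * 29 = 870, so their second moments about 871 are at
    most 870 + 870^2 = 870 * 871, while on the event they tend to 871^2. *)
Lemma extinction_le V : iid_splits P V -> (P (extinction V) <= (870 / 871)%:E)%E.
Proof.
move=> hV; have mV v := iid_measurable _ _ hV v.
have mE := measurable_extinction V mV.
have bW n : bounded_rv (cube_sum V n).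
  by apply: bounded_rv_sum => v _; exact: (bounded_rv_areaX P V hV).
pose f n w := ((cube_sum V n w - 871) ^+ 2)%:E.
have bf n : bounded_rv (fun w => (cube_sum V n w - 871) ^+ 2).
  by apply: bounded_rvX; apply: bounded_rvD; [exact: bW|exact: bounded_rv_cst].
have mf n : measurable_fun setT (f n) by apply/measurable_EFinP; case: (bf n).
have f0 n w : (0 <= f n w)%E by rewrite lee_fin sqr_ge0.
have xiW : forall v a, 0 < a <= 1 -> \int[P]_w cube_diff (V v w) a = 0.
  by move=> v a _; exact: expect_cube_diff.
pose S n w := \sum_(j < n) increment V cube_diff j w.
have bi j : bounded_rv (increment V cube_diff j).
  exact: (bounded_rv_level_increment P V hV _ 1 measurable_cube_diff cube_diff_le).
have bS n : bounded_rv (S n) by apply: bounded_rv_sum => j _; exact: bi.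
have ES n : \int[P]_w S n w = 0.
  rewrite expect_sum; last by move=> j _; exact: bi.
  rewrite big1// => j _.
  exact: (expect_level_increment P V hV _ 1 measurable_cube_diff cube_diff_le xiW).
have ES2 n : \int[P]_w S n w ^+ 2 <= 870.
  rewrite -lee_fin expectE; last exact: bounded_rvX.
  apply: (@le_trans _ _ (\int[P]_w (30%:E * energy V cube_diff w))%E).
    apply: ge0_le_integral => //.
    - by move=> w _; rewrite lee_fin sqr_ge0.
    - by apply/measurable_EFinP; case: (bounded_rvX _ 2 (bS n)).
    - apply: measurable_funeM.
      exact: (measurable_energy P V hV _ 1 measurable_cube_diff cube_diff_le).
    - by move=> w _; exact: sqr_increments_le_energy.
  rewrite ge0_integralZl//; last 2 first.
  - exact: (measurable_energy P V hV _ 1 measurable_cube_diff cube_diff_le).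
  - by move=> w _; exact: energy_ge0.
  rewrite (_ : 870 = 30 * (29 * 1 ^+ 2)); last by ring.
  rewrite EFinM lee_wpmul2l//.
  exact: (integral_energy_le P V hV _ 1 measurable_cube_diff cube_diff_le xiW).
have fle n : (\int[P]_w f n w <= (870 + 870 ^+ 2)%:E)%E.
  rewrite -expectE// lee_fin.
  rewrite (_ : \int[P]_w _ = \int[P]_w (S n w ^+ 2 + ((- 1740) * S n w + 870 ^+ 2))).
    have gen (p q r : R) : \int[P]_w S n w ^+ 2 <= p ->
        \int[P]_w (S n w ^+ 2 + (r * S n w + q)) <= p + q.
      have bc (c : R) : bounded_rv (fun _ : T => c) by exact: bounded_rv_cst.
      have bSr : bounded_rv (fun w => r * S n w) by exact: bounded_rvM.
      rewrite expectD ?expectD ?expectZ ?expect_cst ?ES ?mulr0 ?add0r ?lerD2r//.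
        exact: bounded_rvX.
      exact: bounded_rvD.
    exact: gen (ES2 n).
  by apply: eq_Rintegral => w _; rewrite cube_sumE -/(S n w); ring.
have einf_ge0 w : (0 <= limn_einf (f ^~ w))%E.
  rewrite limn_einf_lim; apply: lime_ge; first exact: is_cvg_einfs.
  by apply: nearW => n; apply: le_ereal_inf_tmp => _ [k _ <-].
have step : ((871 ^+ 2)%:E * P (extinction V) <= (870 + 870 ^+ 2)%:E)%E.
  apply: (@le_trans _ _ (\int[P]_w limn_einf (f ^~ w))%E); last first.
    apply: le_trans (fatou P measurableT mf _) _ => //.
    rewrite limn_einf_lim; apply: lime_le; first exact: is_cvg_einfs.
    apply: nearW => n; apply: le_trans (fle n); apply: ereal_inf_lbound.
    by exists n => /=.
  rewrite -integral_cst// (@eq_integral _ _ _ P _ (fun w => limn_einf (f ^~ w))).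
    apply: ge0_subset_integral => //.
    rewrite (_ : (fun _ => _) = fun w => (- limn_esup (fun n => - f n w))%E).
      apply: measurableT_comp => //; apply: measurable_fun_limn_esup => n.
      exact: measurableT_comp.
    apply/funext => w; rewrite -limn_einfN; congr limn_einf.
    by apply/funext => n; exact/esym/oppeK.
  move=> w; rewrite inE => /cube_limit_eq0 W0.
  have fw : f ^~ w @ \oo --> (871 ^+ 2)%:E.
    apply/fine_cvgP; split; first exact: nearW.
    rewrite (_ : 871 ^+ 2 = (0 - 871) * (0 - 871)); last by ring.
    rewrite (_ : fine \o f ^~ w = fun n => (cube_sum V n w - 871) * (cube_sum V n w - 871)).
      by apply: cvgM; apply: cvgB => //; exact: cvg_cst.
    by apply/funext => n.
  rewrite is_cvg_limn_einfE; first exact/esym/cvg_lim.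
  by apply/cvg_ex; exists (871 ^+ 2)%:E.
move: step; have /fineK <- : P (extinction V) \is a fin_num by rewrite fin_num_measure.
by rewrite -EFinM !lee_fin; lra.
Qed.

(** The event forces its analogues in both subtrees, which are independent; the
    induction on [n] covers all families of splits at once, so that the laws of
    the subtrees need not be compared. *)
Lemma extinction_pow n V : iid_splits P V ->
  (P (extinction V) <= ((870 / 871) ^+ (2 ^ n))%:E)%E.
Proof.
elim: n V => [|n ih] V hV; first by rewrite expn0 expr1; exact: extinction_le.
have mV v := iid_measurable _ _ hV v.
have mE b : measurable (extinction (subtree V b)).
  by apply: measurable_extinction => v; exact: mV.
apply: (@le_trans _ _ (P (extinction (subtree V true) `&` extinction (subtree V false)))).
  apply: le_measure; rewrite ?inE.
  - exact: measurable_extinction.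
  - exact: measurableI.
  - by move=> w W0; split; exact: cube_limit0_subtree.
have sE b : <<s sigma_gen V [set rcons v b | v in setT] >> (extinction (subtree V b)).
  pose T' := g_sigma_algebraType (sigma_gen V [set rcons v b | v in setT]).
  have : measurable_fun setT (cube_limit (subtree V b) : T' -> \bar R).
    apply: (@measurable_cube_limit R _ T') => v _ B mB.
    by apply: sub_gen_smallest; exists (rcons v b) => //; exists B.
  by move=> /(_ measurableT [set 0%E]); rewrite setTI; apply.
rewrite (iid_indep _ _ hV _ _ _ _ _ (sE true) (sE false)); last first.
  rewrite -subset0 => _ [[u _ <-] [v _]] /(congr1 (last true)).
  by rewrite !last_rcons.
rewrite expnS mulnC exprM expr2 EFinM.
by apply: lee_pmul => //; apply: ih; exact: iid_splits_subtree.
Qed.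

Lemma extinction0 V : iid_splits P V -> P (extinction V) = 0%E.
Proof.
move=> hV; apply/eqP; rewrite eq_le measure_ge0 andbT.
have mE : measurable (extinction V).
  by apply: measurable_extinction => v; exact: iid_measurable hV v.
have /fineK E : P (extinction V) \is a fin_num by rewrite fin_num_measure.
rewrite -E lee_fin.
have q0 : (fun n => (870 / 871 : R) ^+ n) @ \oo --> (0 : R).
  by apply: cvg_expr; rewrite ger0_norm; lra.
apply: (@ler_cvg_to _ _ _ _ (fun=> fine (P (extinction V))) _ _ _ (cvg_cst _) q0).
apply: nearW => n; rewrite -lee_fin E.
apply: le_trans (extinction_pow n V hV) _; rewrite lee_fin.
by apply: ler_wiXn2l; [lra|lra|rewrite ltnW// ltn_expl].
Qed.

End positivity.

(** * Counting plates *)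

Section counting_vertices.

(** The vertices of the first [n] generations. *)
Fixpoint first_levels (n : nat) : seq vertex :=
  if n is n'.+1 then first_levels n' ++ level n' else [::].

Lemma mem_first_levels n (v : vertex) : (v \in first_levels n) = (size v < n)%N.
Proof.
elim: n => [|n ih] //=.
by rewrite mem_cat ih mem_level ltnS [RHS]leq_eqVlt orbC.
Qed.

Lemma uniq_first_levels n : uniq (first_levels n).
Proof.
elim: n => //= n ih; rewrite cat_uniq ih uniq_level andbT/=.
apply/hasPn => v; rewrite mem_level => /eqP vn /=.
by rewrite mem_first_levels vn ltnn.
Qed.

Lemma big_first_levels (R : zmodType) n (f : vertex -> R) :
  \sum_(v <- first_levels n) f v = \sum_(j < n) \sum_(v <- level j) f v.
Proof.
elim: n => [|n ih]; first by rewrite big_nil big_ord0.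
by rewrite big_cat ih big_ord_recr.
Qed.

Lemma counting_first_levels (R : realType) (p : pred vertex) n :
  (forall v, p v -> (size v < n)%N) ->
  counting [set v | p v] = (\sum_(j < n) \sum_(v <- level j) (p v)%:R)%:E :> \bar R.
Proof.
move=> pn; rewrite -big_first_levels.
have -> : [set v | p v] = [set` [seq v <- first_levels n | p v]].
  apply/seteqP; split=> v /=; rewrite mem_filter mem_first_levels; last by case/andP.
  by move=> pv; rewrite pv pn.
rewrite /counting asboolT; last exact: finite_seq.
congr EFin; rewrite -natr_sum; congr (_%:R).
transitivity (size [seq v <- first_levels n | p v]); last first.
  rewrite size_filter -sum1_count big_mkcond/=.
  by apply: eq_bigr => v _; case: (p v).
have us : uniq [seq v <- first_levels n | p v] by rewrite filter_uniq ?uniq_first_levels.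
apply: perm_size; apply: uniq_perm => // v.
have := in_fset_set (finite_seq [seq v <- first_levels n | p v]) v.
by rewrite mem_setE.
Qed.

End counting_vertices.

(** * Interpolation between the inverse integers *)

Section interpolation.
Context {R : realType}.

Lemma cvg_inv_succ : (fun m => m.+1%:R^-1 : R) @ \oo --> (0 : R).
Proof. exact: cvg_harmonic. Qed.

(** A nonincreasing function that has the required growth along the inverse
    integers has it along all positive reals: for x between 1/(m+2) and 1/(m+1)
    its value is squeezed between its values at these two points. *)
Lemma cvg_interpolation_inv (N : R -> R) (c : R) :
  (forall x, 0 <= N x) -> (forall x y, 0 < x -> x <= y -> N y <= N x) ->
  (fun k => N k.+1%:R^-1 / k.+1%:R ^+ 3) @ \oo --> c ->
  N x * x ^+ 3 @[x --> 0^'+] --> c.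
Proof.
move=> N0 Nd Nc; set a := (fun k => _) in Nc.
pose r m : R := 1 + m.+1%:R^-1.
have r1 : r @ \oo --> (1 : R).
  by rewrite -[X in _ --> X]addr0; apply: cvgD; [exact: cvg_cst|exact: cvg_inv_succ].
have r3 : (fun m => r m ^+ 3) @ \oo --> (1 : R).
  rewrite (_ : 1 = 1 * (1 * 1)); last by rewrite !mulr1.
  by apply: cvgM => //; apply: cvgM.
have up : (fun m => a m.+1 * r m ^+ 3) @ \oo --> c.
  rewrite -[c]mulr1; apply: cvgM => //.
  by rewrite (cvg_shiftS a).
have lo : (fun m => a m * (r m ^+ 3)^-1) @ \oo --> c.
  rewrite -[c]mulr1 -[X in c * X]invr1; apply: cvgM => //.
  by apply: cvgV => //; exact: oner_neq0.
apply/cvgrPdist_lt => e e0.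
have /cvgrPdist_lt/(_ e e0)[M1 _ H1] := up.
have /cvgrPdist_lt/(_ e e0)[M2 _ H2] := lo.
pose M := maxn M1 M2.
near=> x.
have x0 : 0 < x by near: x; exact: nbhs_right_gt.
have xM : x < M.+2%:R^-1.
  by near: x; apply: nbhs_right_lt; rewrite invr_gt0.
(* With k the integral part of 1/x and k = m+1, x lies between 1/(m+2) and
   1/(m+1). *)
pose k := Num.truncn x^-1.
have /andP[kl ku] : k%:R <= x^-1 < k.+1%:R.
  by apply: truncn_itv; rewrite invr_ge0 ltW.
have Mk : (M.+2 <= k)%N.
  rewrite -ltnS -(ltr_nat R); apply: lt_trans ku.
  by rewrite -[ltLHS]invrK ltf_pV2 ?posrE ?invr_gt0.
case: k kl ku Mk => // m kl ku Mk.
have m0 : 0 < m.+1%:R :> R by [].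
have xm : x <= m.+1%:R^-1 by rewrite -[leLHS]invrK lef_pV2 ?posrE ?invr_gt0.
have mx : m.+2%:R^-1 <= x by rewrite -[leRHS]invrK lef_pV2 ?posrE ?invr_gt0// ltW.
have h1 := H1 m; have h2 := H2 m.
have {}h1 : `|c - a m.+1 * r m ^+ 3| < e.
  by apply: h1; exact: leq_trans (leq_maxl M1 M2) (ltnW Mk).
have {}h2 : `|c - a m * (r m ^+ 3)^-1| < e.
  by apply: h2; exact: leq_trans (leq_maxr M1 M2) (ltnW Mk).
have m20 : m.+2%:R != 0 :> R by rewrite pnatr_eq0.
have m10 : m.+1%:R != 0 :> R by rewrite pnatr_eq0.
have rE : r m = m.+2%:R / m.+1%:R.
  by rewrite /r -[m.+2%:R]natr1 mulrDl mul1r divff.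
have uE : a m.+1 * r m ^+ 3 = N m.+2%:R^-1 * m.+1%:R^-1 ^+ 3.
  rewrite /a rE; move: (m.+2%:R : R) (m.+1%:R : R) m20 m10 => p q p0 q0.
  by field; rewrite p0 q0.
have lE : a m * (r m ^+ 3)^-1 = N m.+1%:R^-1 * m.+2%:R^-1 ^+ 3.
  rewrite /a rE; move: (m.+2%:R : R) (m.+1%:R : R) m20 m10 => p q p0 q0.
  by field; rewrite p0 q0.
have x3 : x ^+ 3 <= m.+1%:R^-1 ^+ 3 by apply: lerXn2r; rewrite ?nnegrE ?invr_ge0// ltW.
have x3' : m.+2%:R^-1 ^+ 3 <= x ^+ 3 by apply: lerXn2r; rewrite ?nnegrE ?invr_ge0// ltW.
have U : N x * x ^+ 3 <= a m.+1 * r m ^+ 3.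
  rewrite uE; apply: ler_pM => //; first exact/exprn_ge0/ltW.
  by apply: Nd => //; rewrite invr_gt0.
have L : a m * (r m ^+ 3)^-1 <= N x * x ^+ 3.
  rewrite lE; by apply: ler_pM => //; exact: Nd.
move: h1 h2; rewrite !ltr_norml => /andP[? ?] /andP[? ?].
by apply/andP; split; lra.
Unshelve. all: by end_near. Qed.

End interpolation.

(** * Almost sure convergence *)

Section pathwise.
Context {R : realType} {T : Type} (V : vertex -> T -> R) (w : T).

(** Whether the plate at [v] is horizontal with area at least [x]. *)
Definition large_plate (x : R) (v : vertex) : bool := (V v w == 2) && (x <= area V v w).

(** The number of large horizontal plates in the first [n] generations. *)
Definition plates (n : nat) (x : R) : R :=
  \sum_(j < n) \sum_(v <- level j) (large_plate x v)%:R.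

Lemma plates_telescope n x :
  plates n x + \sum_(v <- level n) count_mean x (area V v w) =
  count_mean x 1 + \sum_(j < n) increment V (count_diff x) j w.
Proof.
elim: n => [|n ih].
  by rewrite /plates !big_ord0 add0r addr0 /= big_seq1.
rewrite /plates !big_ord_recr/= -/(plates n x) addrA -ih -!addrA; congr (_ + _).
rewrite big_levelS /increment -!big_split/=; apply: eq_bigr => v _.
by rewrite /count_diff /large_plate/=; ring.
Qed.

(** Along the given realization, the areas vanish as the generation grows. *)
Hypothesis small : forall x, 0 < x ->
  exists n0, forall v, (n0 <= size v)%N -> area V v w < x.

(** The number of all horizontal plates with area at least [x]. *)
Definition plate_count (x : R) : \bar R := counting [set v | large_plate x v].

Lemma plate_countE x : 0 < x ->
  \forall n \near \oo, plate_count x = (plates n x)%:E.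
Proof.
move=> /small[n0 n0P]; exists n0 => // n /= n0n.
apply: counting_first_levels => v /andP[_ xv]; rewrite ltnNge; apply/negP => nv.
by have := n0P v (leq_trans n0n nv); rewrite ltNge xv.
Qed.

(** Once all areas are below [x], [count_mean x] is purely cubic. *)
Lemma plates_cube_sum x : 0 < x ->
  \forall n \near \oo, plates n x - 4 / 3 / x ^+ 3 * cube_sum V n w =
    count_mean x 1 + \sum_(j < n) increment V (count_diff x) j w.
Proof.
move=> x0; have [n0 n0P] := small x x0; exists n0 => // n /= n0n.
rewrite -plates_telescope; congr (_ + _).
rewrite /cube_sum mulr_sumr -sumrN big_seq [RHS]big_seq; apply: eq_bigr => v.
rewrite mem_level => /eqP vn; have := n0P v; rewrite vn => /(_ n0n) vx.
by rewrite /count_mean leNgt vx/=; field; rewrite gt_eqF.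
Qed.

Hypothesis cube_energy : (energy V cube_diff w < +oo)%E.

Hypothesis count_energy : (\sum_(k <oo)
  ((k.+1%:R ^- 6)%:E * energy V (count_diff k.+1%:R^-1) w) < +oo)%E.

Lemma cube_sum_cvg : exists l : R, cube_sum V ^~ w @ \oo --> l.
Proof.
have /cvg_ex[l Sl] := energy_cvg V _ w cube_energy.
exists (1 + l); rewrite (_ : cube_sum V ^~ w = fun n =>
    1 + series ((increment V cube_diff) ^~ w) n).
  by apply: cvgD => //; exact: cvg_cst.
by apply/funext => n; rewrite cube_sumE /series/= big_mkord.
Qed.

Lemma plate_count_fin x : 0 < x -> plate_count x = (fine (plate_count x))%:E.
Proof. by move=> /plate_countE[n _ /(_ n) -> /=]. Qed.

Lemma plate_count_inv_cvg (l : R) : cube_sum V ^~ w @ \oo --> l ->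
  (fun k => fine (plate_count k.+1%:R^-1) / k.+1%:R ^+ 3) @ \oo --> 4 / 3 * l.
Proof.
move=> Wl.
pose E k := energy V (count_diff k.+1%:R^-1) w.
pose g k : \bar R := ((k.+1%:R ^- 6)%:E * E k)%E.
have k6 k : 0 < k.+1%:R ^- 6 :> R by rewrite invr_gt0 exprn_gt0.
have g0 k : (0 <= g k)%E.
  by apply: mule_ge0; [rewrite lee_fin ltW|exact: energy_ge0].
have gfin k : g k \is a fin_num.
  rewrite ge0_fin_numE//; apply: le_lt_trans count_energy.
  apply: (@le_trans _ _ (\sum_(0 <= i < k.+1) g i)%E).
    by rewrite big_nat_recr//= leeDr// sume_ge0.
  exact: nneseries_lim_ge.
have gfine : (fun k => fine (g k)) @ \oo --> (0 : R).
  apply: cvg_series_cvg_0; apply: nneseries_lty_cvg; first by move=> k; rewrite fine_ge0.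
  by under eq_eseriesr do rewrite fineK//.
have Efin k : E k \is a fin_num.
  have := gfin k; rewrite /g; have := energy_ge0 V (count_diff k.+1%:R^-1) w.
  rewrite -/(E k); case: (E k) => [r||] //.
  by rewrite gt0_muley ?lte_fin.
pose b k := k.+1%:R^-1 + 60 * fine (g k).
have b0 : b @ \oo --> (0 : R).
  rewrite -[X in _ --> X]addr0 -[X in 0 + X](mulr0 60).
  apply: cvgD; first exact: cvg_inv_succ.
  by apply: cvgM => //; exact: cvg_cst.
pose a k := fine (plate_count k.+1%:R^-1) / k.+1%:R ^+ 3.
(* With x = 1/(k+1), the bound is x plus 60 x^6 times the energy. It holds with
   the sum of cubes over any late generation [n] in place of [l], and passes to
   the limit. *)
have ab k : (a k - 4 / 3 * l) ^+ 2 <= b k.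
  have K0 : 0 < k.+1%:R :> R by [].
  have K1 : 1 <= k.+1%:R :> R by rewrite ler1n.
  set K := k.+1%:R in K0 K1; have x0 : 0 < K^-1 by rewrite invr_gt0.
  have Kn : K != 0 by rewrite gt_eqF.
  have lim : (fun n => (a k - 4 / 3 * cube_sum V n w) ^+ 2) @ \oo --> (a k - 4 / 3 * l) ^+ 2.
    rewrite expr2; under eq_fun do rewrite expr2.
    have c1 : (fun n => a k - 4 / 3 * cube_sum V n w) @ \oo --> a k - 4 / 3 * l.
      by apply: cvgB; [exact: cvg_cst|apply: cvgM => //; exact: cvg_cst].
    exact: cvgM.
  apply: (@ler_cvg_to _ _ _ _ _ (fun=> b k) _ _ lim (cvg_cst _)).
  near=> n.
  have pE : plate_count K^-1 = (plates n K^-1)%:E.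
    by near: n; exact: plate_countE.
  have tele : plates n K^-1 - 4 / 3 / K^-1 ^+ 3 * cube_sum V n w =
      count_mean K^-1 1 + \sum_(j < n) increment V (count_diff K^-1) j w.
    by near: n; exact: plates_cube_sum.
  set I := \sum_(j < n) increment V (count_diff K^-1) j w in tele.
  have I2 : I ^+ 2 <= 30 * fine (E k).
    rewrite -lee_fin [leRHS]EFinM fineK//; exact: sqr_increments_le_energy.
  have ge : fine (g k) = K ^- 6 * fine (E k) by rewrite /g fineM.
  have aE : a k - 4 / 3 * cube_sum V n w = K ^- 3 * (- 3^-1 + I).
    have -> : - 3^-1 = count_mean K^-1 1 by rewrite /count_mean invf_le1// K1.
    rewrite -tele /a -/K pE /=.
    have alg (q p c : R) : q != 0 ->
        p / q ^+ 3 - 4 / 3 * c = q ^- 3 * (p - 4 / 3 / q^-1 ^+ 3 * c).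
      by move=> q0; field.
    exact: alg.
  rewrite aE exprMn /b ge -/K.
  have -> : (K ^- 3) ^+ 2 = K ^- 6 by rewrite -exprVn -exprM exprVn.
  have K6 : K ^- 6 <= K^-1.
    by rewrite lef_pV2 ?posrE ?exprn_gt0// -[leLHS]expr1 ler_weXn2l.
  have : (- 3^-1 + I) ^+ 2 <= 1 + 60 * fine (E k).
    by have := sqr_ge0 (I + 3^-1); move: I2; nra.
  have := k6 k; rewrite -/K => K60 h.
  apply: (@le_trans _ _ (K ^- 6 * (1 + 60 * fine (E k)))); first by rewrite ler_pM2l.
  by rewrite mulrDr mulr1 (mulrCA 60) lerD2r.
apply/cvgrPdist_lt => e e0.
have e20 : 0 < e ^+ 2 by rewrite exprn_gt0.
have /cvgrPdist_lt/(_ _ e20) := b0; apply: filterS => k.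
rewrite sub0r normrN => bk; rewrite distrC.
rewrite -(@ltr_pXn2r _ 2) ?nnegrE ?(ltW e0)// real_normK ?num_real//.
exact: le_lt_trans (ab k) (le_lt_trans (ler_norm _) bk).
Unshelve. all: by end_near. Qed.

Lemma plate_count_cvg (l : R) : cube_sum V ^~ w @ \oo --> l ->
  (plate_count x * (x ^+ 3)%:E)%E @[x --> 0^'+] --> (4 / 3 * l)%:E.
Proof.
move=> Wl; pose N x := if 0 < x then fine (plate_count x) else 0.
have pc0 x : (0 <= plate_count x)%E.
  by rewrite /plate_count /counting; case: ifP; rewrite ?leey// lee_fin.
have N0 x : 0 <= N x by rewrite /N; case: ifP => // _; rewrite fine_ge0.
have Nd x y : 0 < x -> x <= y -> N y <= N x.
  move=> x0 xy; have y0 := lt_le_trans x0 xy; rewrite /N x0 y0.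
  near \oo => n.
  rewrite (_ : plate_count x = (plates n x)%:E); last by near: n; exact: plate_countE.
  rewrite (_ : plate_count y = (plates n y)%:E); last by near: n; exact: plate_countE.
  apply: ler_sum => j _; apply: ler_sum => v _; rewrite ler_nat /large_plate.
  by case: (_ == 2) => //=; case: (lerP y) => // ya; rewrite (le_trans xy ya).
have NE : (fun k => N k.+1%:R^-1 / k.+1%:R ^+ 3) =
    fun k => fine (plate_count k.+1%:R^-1) / k.+1%:R ^+ 3.
  by apply/funext => k; rewrite /N invr_gt0 ltr0n.
have /(cvg_interpolation_inv N _ N0 Nd) :
    (fun k => N k.+1%:R^-1 / k.+1%:R ^+ 3) @ \oo --> 4 / 3 * l.
  by rewrite NE; exact: plate_count_inv_cvg.
move=> Nc; apply: (@cvg_trans _ ((N x * x ^+ 3)%:E @[x --> 0^'+])); last first.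
  by apply/fine_cvgP; split; first exact: nearW.
apply: near_eq_cvg; near=> x.
have x0 : 0 < x by near: x; exact: nbhs_right_gt.
by rewrite /N x0 plate_count_fin.
Unshelve. all: by end_near. Qed.

End pathwise.

Section almost_sure.
Context {d} {T : measurableType d} {R : realType} (P : probability T R).

(** The sums of the fourth powers of the areas are summable over the
    generations. *)
Lemma areas_vanish (V : vertex -> T -> R) : iid_splits P V ->
  {ae P, forall w, forall x, 0 < x ->
    exists n0, forall v, (n0 <= size v)%N -> area V v w < x}.
Proof.
move=> hV; pose f n w := (\sum_(v <- level n) area V v w ^+ 4)%:E : \bar R.
have bS n : bounded_rv (fun w => \sum_(v <- level n) area V v w ^+ 4).
  by apply: bounded_rv_sum => v _; exact: (bounded_rv_areaX P V hV).
have S0 n w : 0 <= \sum_(v <- level n) area V v w ^+ 4.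
  apply: sumr_ge0 => v _; rewrite exprn_ge0//.
  by have /andP[/ltW] := area_range V v w.
have mf n : measurable_fun setT (f n) by apply/measurable_EFinP; case: (bS n).
have f0 n w : (0 <= f n w)%E by rewrite lee_fin.
have : {ae P, forall w, (\sum_(n <oo) f n w < +oo)%E}.
  apply: (ae_lty P _ 15).
  - by apply: ge0_emeasurable_sum => // n _.
  - by move=> w; exact: nneseries_ge0.
  - apply: (integral_series_le P f (fun n => (14 / 15) ^+ n)) => // n.
      by rewrite -expectE// lee_fin (expect_level_area4 P V hV).
    apply: (le_trans (@geometric_sum_le _ (14 / 15) n _)); first lra.
    by rewrite (_ : 1 - 14 / 15 = 15^-1) ?invrK//; field.
apply: filterS => w /(nneseries_lty_cvg _ (S0 ^~ w)) /cvg_series_cvg_0 Sw x x0.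
have x40 : 0 < x ^+ 4 by rewrite exprn_gt0.
have /cvgrPdist_lt/(_ _ x40)[n0 _ n0P] := Sw.
exists n0 => v vn; have := n0P (size v) vn.
rewrite /= sub0r normrN ger0_norm// => Sx.
have /andP[/ltW a0 _] := area_range V v w.
rewrite -(@ltr_pXn2r _ 4) ?nnegrE ?(ltW x0)//.
apply: le_lt_trans Sx; rewrite (bigD1_seq v) ?uniq_level ?mem_level//=.
rewrite lerDl sumr_ge0// => u _; rewrite exprn_ge0//.
by have /andP[/ltW] := area_range V u w.
Qed.

Lemma cube_energy_lty (V : vertex -> T -> R) : iid_splits P V ->
  {ae P, forall w, (energy V cube_diff w < +oo)%E}.
Proof.
move=> hV; apply: (ae_lty P _ (29 * 1 ^+ 2)).
- exact: (measurable_energy P V hV _ 1 measurable_cube_diff cube_diff_le).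
- by move=> w; exact: energy_ge0.
- apply: (integral_energy_le P V hV _ 1 measurable_cube_diff cube_diff_le) => v a _.
  exact: expect_cube_diff.
Qed.

Lemma inv_sqr_sum_le n : \sum_(k < n) k.+1%:R ^- 2 <= 2 :> R.
Proof.
have : \sum_(k < n.+1) k.+1%:R ^- 2 <= 2 - n.+1%:R^-1 :> R.
  elim: n => [|n ih]; first by rewrite big_ord_recr big_ord0/= add0r expr1n invr1; lra.
  rewrite big_ord_recr/=; apply: (le_trans (lerD ih (lexx _))).
  have n0 : 0 < n.+1%:R :> R by [].
  rewrite -[n.+2%:R]natr1; move: (n.+1%:R : R) n0 => m m0.
  rewrite -subr_ge0.
  have -> : 2 - (m + 1)^-1 - (2 - m^-1 + (m + 1) ^- 2) = (m * (m + 1) ^+ 2)^-1.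
    by field; rewrite !gt_eqF//; lra.
  by rewrite invr_ge0 mulr_ge0 ?sqr_ge0// ltW.
rewrite big_ord_recr/= => h; apply: le_trans (le_trans h _).
  by rewrite lerDl invr_ge0 exprn_ge0.
by rewrite lerBlDr lerDl invr_ge0.
Qed.

(** At x = 1/(k+1) the energy has mean at most 29 * (5 (k+1)^2)^2 = 725 (k+1)^4. *)
Lemma count_energy_lty (V : vertex -> T -> R) : iid_splits P V ->
  {ae P, forall w, (\sum_(k <oo)
    ((k.+1%:R ^- 6)%:E * energy V (count_diff k.+1%:R^-1) w) < +oo)%E}.
Proof.
move=> hV; have x0 k : 0 < k.+1%:R^-1 :> R by rewrite invr_gt0.
have mE k : measurable_fun setT (energy V (count_diff k.+1%:R^-1)).
  exact: (measurable_energy P V hV _ _ (measurable_count_diff _) (count_diff_le _ (x0 k))).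
have k6 k : 0 <= k.+1%:R ^- 6 :> R by rewrite invr_ge0 exprn_ge0.
apply: (ae_lty P _ (725 * 2)).
- apply: ge0_emeasurable_sum.
    by move=> k w _ _; rewrite mule_ge0 ?lee_fin ?energy_ge0.
  by move=> k _; exact: measurable_funeM.
- by move=> w; apply: nneseries_ge0 => k _ _; rewrite mule_ge0 ?lee_fin ?energy_ge0.
- apply: (integral_series_le P _ (fun k => 725 * k.+1%:R ^- 2)).
  + by move=> k; exact: measurable_funeM.
  + by move=> k w; rewrite mule_ge0 ?lee_fin ?energy_ge0.
  + move=> k; rewrite ge0_integralZl//; last by move=> w _; exact: energy_ge0.
    have := integral_energy_le P V hV _ _ (measurable_count_diff _)
      (count_diff_le _ (x0 k)) (fun v a => expect_count_diff P V hV _ (x0 k) v a).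
    have k60 : (0 <= (k.+1%:R ^- 6)%:E :> \bar R)%E by rewrite lee_fin.
    move=> /(lee_wpmul2l k60) /le_trans; apply; rewrite -EFinM lee_fin.
    rewrite le_eqVlt; apply/orP; left; apply/eqP.
    have : k.+1%:R != 0 :> R by rewrite pnatr_eq0.
    by move: (k.+1%:R : R) => q q0; field.
  + move=> n; rewrite -mulr_sumr; apply: ler_wpM2l; first exact: ler0n.
    exact: inv_sqr_sum_le.
Qed.

Variables (U : vertex -> {RV P >-> R}) (D : vertex -> T -> direction).
Hypothesis hUD : unbiased_fragmentation U D.

Lemma uniform_in_unit_interval : {ae P, forall w, forall v, 0 < U v w < 1}.
Proof.
have H1 v : {ae P, forall w, 0 < U v w < 1}.
  have mA : measurable (U v @^-1` `]0, 1[) by exact: measurable_funPTI.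
  pose f : R -> R := \1_(`]0, 1[%classic).
  have mf : measurable_fun setT f by exact: measurable_indic.
  have bf : exists M, forall y, `|f y| <= M.
    by exists 1 => y; rewrite /f indicE; case: (_ \in _); rewrite ?normr1 ?normr0.
  have PA : fine (P (U v @^-1` `]0, 1[)) = 1.
    transitivity (\int[P]_w f (U v w)).
      by rewrite /Rintegral integral_indic ?setIT.
    rewrite (uniform_expect P U D hUD v f mf bf) Rintegral01_oo//; last first.
      by case: bf => M fM; exists M => y _.
    rewrite (@eq_Rintegral _ _ _ _ _ (fun=> 1)); last first.
      by move=> y y01; rewrite /f indicE y01.
    by rewrite Rintegral_cst//= lebesgue_measure_itv/= lte01 oppr0 adde0 mulr1.
  exists (~` (U v @^-1` `]0, 1[)); split.
  - exact: measurableC.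
  - by rewrite probability_setC// -[P _]fineK ?fin_num_measure// PA subee.
  - by move=> w /= nU; rewrite /= in_itv.
have : {ae P, forall w, forall n, if unpickle n is Some v then 0 < U v w < 1 else true}.
  by apply/ae_foralln => n; case: unpickle => [v|]; [exact: H1|exact: aeW].
by apply: filterS => w h v; have := h (pickle v); rewrite pickleK.
Qed.

Lemma area_split_of w : (forall v, 0 < U v w < 1) -> forall v,
  horizontal_plate_area U D v w = area (split_of P U D) v w.
Proof.
move=> U01; elim=> [|b v ih]; first by rewrite /horizontal_plate_area/= mulr1.
rewrite [RHS]/= -ih /horizontal_plate_area/= /ratio /split_of.
have Uv := U01 v; have /andP[U0 U1] := Uv.
have U2 : (U v w == 2) = false by apply/negbTE/eqP => u2; move: U1; rewrite u2; lra.
have cU : clamp (U v w) = U v w by rewrite /clamp Uv.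
have := ltn_ord (D v w); case De: (D v w) => [[|[|[|m]]] lt3] //= _.
- by rewrite U2 cU; case: b; ring.
- by rewrite U2 cU; case: b; ring.
- by rewrite eqxx mulr1.
Qed.

Lemma N_h_plate_count w : (forall v, 0 < U v w < 1) -> forall x,
  N_h U D w x = plate_count (split_of P U D) w x.
Proof.
move=> U01 x; rewrite /N_h /plate_count; congr counting.
apply/seteqP; split=> v /=; rewrite /large_plate area_split_of// /split_of.
  by case=> -> ->; rewrite eqxx eqxx.
case: (D v w =P e3) => [_ /andP[_ ->]//|_ /andP[/eqP u2]].
by have := U01 v; rewrite u2; lra.
Qed.

End almost_sure.

Theorem theorem1p2 (R : realType) (d : measure_display) (T : measurableType d)
    (P : probability T R)
    (U : vertex -> {RV P >-> R}) (D : vertex -> T -> direction)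
    (hUD : unbiased_fragmentation U D) :
  exists W : {RV P >-> \bar R},
    nondegenerate_rv W /\
    {ae P, forall w, (N_h U D w x * (x ^+ 3)%:E)%E @[x --> (0 : R)^'+] --> W w}.
Proof.
pose V := split_of P U D.
have hV : iid_splits P V := unbiased_iid_splits P U D hUD.
pose W0 w := ((4 / 3)%:E * cube_limit V w)%E.
have mW0 : measurable_fun setT W0.
  apply: measurable_funeM; apply: measurable_cube_limit => v.
  exact: iid_measurable hV v.
pose W : {RV P >-> \bar R} := HB.pack W0 (isMeasurableFun.Build _ _ _ _ W0 mW0).
have aecube := cube_energy_lty P V hV.
exists W; split.
  have ext0 : {ae P, forall w, ~ extinction V w}.
    exists (extinction V); split.
    - by apply: measurable_extinction => v; exact: iid_measurable hV v.
    - exact: extinction0.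
    - by move=> w /= /contrapT.
  apply: filterS2 aecube ext0 => w Ew next.
  have [l Wl] := cube_sum_cvg V w Ew.
  have cl := cube_limitE V w l Wl.
  have l0 : 0 <= l.
    apply: (@ler_cvg_to _ _ _ _ (fun=> 0) _ _ _ (cvg_cst _) Wl).
    by apply: nearW => n; exact: cube_sum_ge0.
  have lgt0 : 0 < l.
    rewrite lt_neqAle l0 andbT; apply/negP => /eqP le0.
    by apply: next; rewrite /extinction/= cl -le0.
  rewrite /= /W0 cl -EFinM ltry lte_fin mulr_gt0//; split=> //; lra.
apply: filterS2 (uniform_in_unit_interval P U D hUD)
  (filterI (areas_vanish P V hV) (filterI aecube (count_energy_lty P V hV))).
move=> w U01 [small [Ew Cw]].
have [l Wl] := cube_sum_cvg V w Ew.
rewrite /= /W0 (cube_limitE V w l Wl) -EFinM.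
under eq_fun do rewrite (N_h_plate_count P U D w U01).
exact: plate_count_cvg.
Qed.
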